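(* Let $C\subset\mathbb{R}^2$ be an oval of Euclidean constant width $w$. Then $$\delta_{\operatorname{ART}}(C)<\frac{\pi}{3(\pi-\sqrt3)}.$$
   Context: An oval is a smooth ($C^\infty$), strictly convex simple closed curve $C\subset\mathbb{R}^2$ with positive curvature; $\operatorname{int}(C)$ is the open region it bounds. For $x\in C$, $\iota_C(x)\in C$ is the unique point different from $x$ whose tangent line is parallel to $T_xC$. $\Phi_C$ sends a line $\overline{xy}$ ($x\ne y\in C$) to $\overline{\iota_C(x)\iota_C(y)}$; $\Lambda_p$ is the pencil of lines through $p\in\operatorname{int}(C)$; $\operatorname{ART}_C(p)$ is the envelope of the line family $\Phi_C(\Lambda_p)$. Put $n(\theta)=(\cos\theta,\sin\theta)$, $\tau(\theta)=(-\sin\theta,\cos\theta)$. For each $\theta$ there is exactly one line of $\Phi_C(\Lambda_p)$ with normal $n(\theta)$, written $n(\theta)\cdot(z-p)=q_p(\theta)$, with $q_p$ smooth and $q_p(\theta+\pi)=-q_p(\theta)$. $\operatorname{ART}_C(p)$ is the closed front $X_p(\theta)=p+q_pn+q_p'\tau$, $\theta\in[0,\pi]$, with oriented area $A^*(\operatorname{ART}_C(p))=\frac12\oint[X_p,dX_p]=\frac12\int_0^\pi(q_p^2-(q_p')^2)\,d\theta$, where $[u,v]=\det(u,v)$. Energy: $\mathcal E_C(p)=-A^*(\operatorname{ART}_C(p))$ for $p\in\operatorname{int}(C)$ and $\mathcal E_C(p)=0$ for $p\in C$. With $A(C)$ the area enclosed by $C$, $\delta_{\operatorname{ART}}(C)=\max_{p\in\overline{\operatorname{int}(C)}}\mathcal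 E_C(p)/A(C)$. *)

(* Defs.v *)
From HB Require Import structures.
From mathcomp Require Import all_boot all_order all_algebra.
From mathcomp Require Import all_classical all_reals all_analysis.

Set Implicit Arguments.
Unset Strict Implicit.
Unset Printing Implicit Defensive.

Import Order.TTheory GRing.Theory Num.Theory.
Import numFieldNormedType.Exports.

Local Open Scope classical_set_scope.
Local Open Scope ring_scope.

Section Plane.
Context {R : realType}.
Implicit Types (u v x y z p : R * R) (t : R).

Definition dot u v : R := u.1 * v.1 + u.2 * v.2.

Definition cross u v : R := u.1 * v.2 - u.2 * v.1.

(* The library norm on [R * R] is the max norm, hence this one. *)
Definition enorm u : R := Num.sqrt (dot u u).

Definition normal t : R * R := (cos t, sin t).

Definition tau t : R * R := (- sin t, cos t).

(* A line when [x <> y]. *)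
Definition line_through x y : set (R * R) := [set z | cross (y - x) (z - x) = 0].

Definition smooth (gamma : R -> R * R) : Prop :=
  forall (k : nat) t, derivable (derive1n k gamma) t 1.

Definition curvature (gamma : R -> R * R) t : R :=
  cross (derive1 gamma t) (derive1n 2 gamma t) / enorm (derive1 gamma t) ^+ 3.

Definition planar_area (A : set (R * R)) : R :=
  fine ((@lebesgue_measure R \x @lebesgue_measure R)%E
          (A : set (measurableTypeR R * measurableTypeR R))).

(* (1/2) \oint [X, dX] for a closed curve parametrized by [[a, b]]. *)
Definition oriented_area (a b : R) (X : R -> R * R) : R :=
  2^-1 * (\int[@lebesgue_measure R]_(t in `[a, b]) cross (X t) (derive1 X t))%R.

End Plane.

(* An oval is given by a regular parametrization over one period [2 * pi], and
   the curve is [range gamma]. Strict convexity says that the curve lies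
   strictly on one side of each of its tangent lines, apart from the point of
   contact; the side is the left one, which only fixes the direction of travel
   (counterclockwise). *)
Record oval {R : realType} (gamma : R -> R * R) : Prop := Oval {
  oval_smooth : smooth gamma;
  oval_regular : forall t, derive1 gamma t != 0;
  oval_closed : forall t, gamma (t + 2 * pi) = gamma t;
  oval_simple : forall s t, 0 <= s < 2 * pi -> 0 <= t < 2 * pi ->
    gamma s = gamma t -> s = t;
  oval_strictly_convex : forall s t, gamma s <> gamma t ->
    0 < cross (derive1 gamma t) (gamma s - gamma t);
  oval_curvature : forall t, 0 < curvature gamma t
}.

Section Oval.
Context {R : realType}.
Variable gamma : R -> R * R.
Implicit Types (x y z p : R * R) (t : R).

(* The bounded part of the complement of the curve. *)
Definition inside : set (R * R) :=
  [set z | (~` range gamma) z /\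
           bounded_set (connected_component (~` range gamma) z)].

Definition enclosed_area : R := planar_area inside.

(* Distance between the two supporting lines with normal [normal t]. *)
Definition width t : R :=
  sup [set dot (normal t) z | z in range gamma]
  - inf [set dot (normal t) z | z in range gamma].

Definition constant_width (w : R) : Prop := forall t, width t = w.

Definition parallel_tangents x y : Prop :=
  exists s t, [/\ gamma s = x, gamma t = y &
                  cross (derive1 gamma s) (derive1 gamma t) = 0].

(* For an oval and [x] on it, the choice made by [xget] is forced. *)
Definition iota_oval x : R * R :=
  xget x [set y | y <> x /\ parallel_tangents x y].

(* The family Phi_C (Lambda_p), as a set of lines. *)
Definition Phi_pencil p : set (set (R * R)) :=
  [set L | exists x y, [/\ range gamma x, range gamma y, x <> y,
             line_through x y p &
             L = line_through (iota_oval x) (iota_oval y)]].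

(* For an oval and [p] inside it, the choice made by [xget] is forced. *)
Definition ART_offset p t : R :=
  xget 0 [set q | Phi_pencil p [set z | dot (normal t) (z - p) = q]].

Definition ART_front p t : R * R :=
  p + ART_offset p t *: normal t + derive1 (ART_offset p) t *: tau t.

Definition ART_area p : R := oriented_area 0 pi (ART_front p).

Definition ART_energy p : R :=
  if `[< inside p >] then - ART_area p else 0.

(* The maximum of the normalized energy over the closed region, taken as a
   supremum in the extended reals so that no default value can occur. *)
Definition delta_ART : \bar R :=
  ereal_sup [set (ART_energy p / enclosed_area)%:E | p in closure inside].

End Oval.

(* Main.v *)
Require Import Defs.
From mathcomp Require Import all_boot all_order all_algebra.
From mathcomp Require Import all_classical all_reals all_analysis.
From mathcomp Require Import measurable_realfun.
From mathcomp Require Import ring lra zify.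
Import Order.TTheory GRing.Theory Num.Theory.
Import numFieldNormedType.Exports.
Local Open Scope ring_scope.
Local Open Scope classical_set_scope.
Set Implicit Arguments.
Unset Strict Implicit.
Unset Printing Implicit Defensive.

(* Constant width gives [h(a) + h(a + pi) = w] for the support function [h]. By
   the intermediate value theorem the curve has a circumscribed regular hexagon;
   call its centre [o]. The hexagon lies in the disc of radius [w / sqrt 3] about
   [o], and the curve even stays inside a smaller concentric disc, since at a
   vertex of the hexagon a smooth curve cannot have two tangent lines.

   The energy does not depend on the origin, so it equals half the integral of
   [q'^2 - q^2] for the support function [q] of the front about [o], hence is at
   most half the integral over [[0, pi]] of [q^2 + q'^2 = |X - o|^2]. The front
   point [X] lies on the chord that it is tangent to, therefore inside the smaller
   disc, and the energy is at most [pi r / 2] for some [r < w^2 / 3].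

   On the other hand [A = (1/2) int h rho] with [h(a) = w - h(a + pi)], and
   [h(a + pi)] is at most the support function of the hexagon (Chakerian's proof
   of the Blaschke-Lebesgue inequality), so [A >= (pi - sqrt 3) w^2 / 2]. *)

(** * Derivatives and smooth functions of a real variable *)

(** The constant is the quotient of [(pi / 2) * (w ^+ 2 / 3)] by [(pi - Num.sqrt 3) / 2 * w ^+ 2].
    Since [delta_ART] is a supremum, strict bounds for the individual [p] would not survive; the
    strictness has to sit in one radius that serves all [p], and compactness of the curve supplies
    it. That the front point lies between the endpoints of the image chord, and not merely on its
    line, has a kinematic reason. When a line turns about an interior point [p], both ends of its
    chord advance in the same sense along the curve, hence so do their antipodes. Each antipode
    turns the image chord in the same sense, so the instantaneous centre of rotation, which is the
    point of contact with the envelope, separates the two ends. Everything is computed in the normal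
    angle, where [iota_oval] is the shift by [pi]. Hence two preliminaries: an arbitrary regular
    parametrization has to be changed to this one, and the topological interior has to be recognized
    as an intersection of half-planes. For the area a lower bound suffices, because it stands in the
    denominator. *)

Section Calculus.
Context {R : realType}.
Implicit Types (f g df dg : R -> R) (t x a b l : R).

Definition derivative f df := forall t, is_derive t 1 f (df t).

Lemma is_derive_congr f t l (l0 : R) : is_derive t 1 f l -> l = l0 -> is_derive t 1 f l0.
Proof. by move=> ? <-. Qed.

Lemma is_derive_add f g t a b : is_derive t 1 f a -> is_derive t 1 g b ->
  is_derive t 1 (fun s => f s + g s) (a + b : R).
Proof. by move=> ? ?; exact: is_deriveD. Qed.

Lemma is_derive_opp f t a : is_derive t 1 f a -> is_derive t 1 (fun s => - f s) (- a).
Proof. by move=> ?; exact: is_deriveN. Qed.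

Lemma is_derive_mul f g t a b : is_derive t 1 f a -> is_derive t 1 g b ->
  is_derive t 1 (fun s => f s * g s) (a * g t + f t * b).
Proof.
move=> fa gb; have := @is_deriveM _ _ f g t 1 a b fa gb.
by rewrite mulrfctE => h; apply: is_derive_congr h _; rewrite addrC mulrC.
Qed.

Lemma is_derive_inv f t a : f t != 0 -> is_derive t 1 f a ->
  is_derive t 1 (fun s => (f s)^-1) (- (a / f t ^+ 2)).
Proof.
move=> f0 fa; have h := @is_deriveV R f t a 1 f0 fa.
by apply: is_derive_congr h _; rewrite /GRing.scale /= mulNr mulrC.
Qed.

Lemma is_derive_const (c t : R) : is_derive t 1 (fun=> c) 0.
Proof. exact: is_derive_cst. Qed.

Lemma is_derive_self t : is_derive t 1 (fun s : R => s) 1.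
Proof. exact: is_derive_id. Qed.

Lemma is_derive_compose f g t a b : is_derive (g t) 1 f a -> is_derive t 1 g b ->
  is_derive t 1 (fun s => f (g s)) (a * b).
Proof.
by move=> fa gb; exact: (@is_derive1_comp R f g t a b fa gb).
Qed.

Lemma is_derive_sin_comp f t a : is_derive t 1 f a ->
  is_derive t 1 (fun s => sin (f s)) (cos (f t) * a).
Proof. by move=> fa; apply: is_derive_compose. Qed.

Lemma is_derive_cos_comp f t a : is_derive t 1 f a ->
  is_derive t 1 (fun s => cos (f s)) (- (sin (f t) * a)).
Proof. by move=> fa; rewrite -mulNr; apply: is_derive_compose. Qed.

Lemma is_derive_atan_comp f t a : is_derive t 1 f a ->
  is_derive t 1 (fun s => atan (f s)) ((1 + f t ^+ 2)^-1 * a).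
Proof. by move=> fa; apply: is_derive_compose. Qed.

End Calculus.

Ltac derive_step := lazymatch goal with
  | |- is_derive _ _ (fun s => s) _ => notypeclasses refine (is_derive_self _)
  | |- is_derive _ _ (fun s => @?f s + @?g s) _ => notypeclasses refine (is_derive_add _ _)
  | |- is_derive _ _ (fun s => - @?f s) _ => notypeclasses refine (is_derive_opp _)
  | |- is_derive _ _ (fun s => @?f s * @?g s) _ => notypeclasses refine (is_derive_mul _ _)
  | |- is_derive _ _ (fun s => sin (@?f s)) _ => notypeclasses refine (is_derive_sin_comp _)
  | |- is_derive _ _ (fun s => cos (@?f s)) _ => notypeclasses refine (is_derive_cos_comp _)
  | |- is_derive _ _ (fun s => atan (@?f s)) _ => notypeclasses refine (is_derive_atan_comp _)
  | |- is_derive _ _ (fun s => (@?f s) ^+ 2) _ => notypeclasses refine (is_derive_mul _ _)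
  | |- is_derive _ _ ( *%R ?c) _ =>
      notypeclasses refine (is_derive_mul (f := fun=> c) (g := fun s => s) _ _)
  | |- is_derive _ _ (+%R ?c) _ =>
      notypeclasses refine (is_derive_add (f := fun=> c) (g := fun s => s) _ _)
  | |- is_derive _ _ -%R _ => notypeclasses refine (is_derive_opp (f := fun s => s) _)
  | |- is_derive _ _ sin _ => exact: is_derive_sin
  | |- is_derive _ _ cos _ => exact: is_derive_cos
  | H : derivative ?f _ |- is_derive _ _ ?f _ => exact: H
  | H : derivative ?f _ |- is_derive _ _ (fun s => ?f s) _ => exact: H
  | H : derivative ?f _ |- is_derive _ _ (fun s => ?f (@?g s)) _ =>
      notypeclasses refine (is_derive_compose (H _) _)
  | |- _ => notypeclasses refine (is_derive_const _ _)
  end.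
Ltac derive_tac := notypeclasses refine (is_derive_congr _ _); [repeat derive_step|].

Section Calculus2.
Context {R : realType}.
Implicit Types (f g df dg : R -> R) (t x a b l : R).

Lemma derivative_continuous f df : derivative f df -> continuous f.
Proof.
move=> H t; apply: differentiable_continuous; apply/derivable1_diffP.
by case: (H t).
Qed.

Lemma derivative_within_continuous f df (a b : R) : derivative f df ->
  {within `[a, b], continuous f}.
Proof. by move=> H; apply: continuous_subspaceT; exact: derivative_continuous H. Qed.

Lemma is_derive_unique f t a b :
  is_derive t 1 f a -> is_derive t 1 f b -> a = b.
Proof. by case=> _ <- [_ <-]. Qed.

Lemma derivative_unique f df dg : derivative f df -> derivative f dg -> df = dg.
Proof.
by move=> F1 F2; apply/funext => t; exact: is_derive_unique (F1 t) (F2 t).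
Qed.

Lemma derivative1E f df : derivative f df -> f^`() = df.
Proof. by move=> F; apply/funext => t; rewrite derive1E; case: (F t). Qed.

Lemma derivative_mvt f df x y : derivative f df -> x < y ->
  exists2 c, x < c < y & f y - f x = df c * (y - x).
Proof.
move=> F xy; have [|c] := @MVT _ f df _ _ xy (fun t _ => F t).
  exact: derivative_within_continuous F.
by rewrite in_itv /= => ? ?; exists c.
Qed.

Lemma derivative_incr f df : derivative f df -> (forall t, 0 < df t) ->
  {mono f : x y / x <= y}.
Proof.
move=> F p; apply: le_mono => x y xy.
have [c _ E] := derivative_mvt F xy.
by rewrite -subr_gt0 E mulr_gt0 // subr_gt0.
Qed.

Lemma derivative_le f df (x y : R) : derivative f df -> x <= y ->
  (forall t, x < t < y -> 0 <= df t) -> f x <= f y.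
Proof.
move=> F; rewrite le_eqVlt => /orP[/eqP-> //|xy] p.
have [c /p cp E] := derivative_mvt F xy.
by rewrite -subr_ge0 E mulr_ge0 // subr_ge0 ltW.
Qed.

Lemma derivative_lt f df (x y : R) : derivative f df -> x < y ->
  (forall t, x < t < y -> 0 < df t) -> f x < f y.
Proof.
move=> F xy p; have [c /p cp E] := derivative_mvt F xy.
by rewrite -subr_gt0 E mulr_gt0 // subr_gt0.
Qed.

Lemma derivative_cst f : derivative f (fun=> 0) -> forall x y, f x = f y.
Proof.
move=> F x y; wlog xy : x y / x < y => [hw|].
  by case: (ltgtP x y) => [| |->//]; [|move=> ?; symmetry]; exact: hw.
have [c _] := derivative_mvt F xy; rewrite mul0r => /eqP.
by rewrite subr_eq0 eq_sym => /eqP.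
Qed.

Lemma derivative_shift f df (c : R) : derivative f df ->
  derivative (fun t => f (t + c)) (fun t => df (t + c)).
Proof. move=> F t; derive_tac; by rewrite addr0 mulr1. Qed.

Lemma derivative_periodic f df (c : R) : derivative f df ->
  (forall t, f (t + c) = f t) -> forall t, df (t + c) = df t.
Proof.
move=> F per t; have E : (fun u => f (u + c)) = f by apply/funext.
have := derivative_shift c F; rewrite E => F'.
exact: is_derive_unique (F' t) (F t).
Qed.

Lemma continuous_sign f (x : R) : continuous f -> (forall t, f t != 0) ->
  0 < f x -> forall t, 0 < f t.
Proof.
move=> fc f0 fx t; rewrite ltNge; apply/negP => ft.
wlog xt : f x t fc f0 fx ft / x <= t => [hw|].
  case: (leP x t) => [|/ltW tx]; first exact: hw fc f0 fx ft.
  apply: (hw (fun s => f (- s)) (- x) (- t)); rewrite ?opprK ?lerN2 //.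
  by move=> s; apply: (@continuous_comp _ _ _ -%R f); [exact: oppr_continuous|exact: fc].
have [||c _ /eqP] := @IVT R f x t 0 xt.
- exact: continuous_subspaceT.
- by rewrite ge_min le_max ft (ltW fx) orbT.
- by rewrite (negbTE (f0 c)).
Qed.

Lemma derivative_inverse f df : derivative f df -> (forall t, 0 < df t) ->
  (forall y, exists x, f x = y) ->
  exists2 g, cancel f g /\ cancel g f & derivative g (fun y => (df (g y))^-1).
Proof.
move=> F p surj; have mf := derivative_incr F p.
pose g y := xget 0 [set x | f x = y].
have gK : cancel g f.
  by move=> y; rewrite /g; case: xgetP => // n; have [x] := surj y; move/n.
have fK : cancel f g by move=> x; apply: (inc_inj mf); rewrite gK.
exists g => // y; rewrite -{1}(gK y).
apply: is_derive_inverse; [by apply: filterE => x; exact: fK| |exact: F|by rewrite lt0r_neq0].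
by apply: filterE => x; exact: (derivative_continuous F).
Qed.

(** An integral from a fixed base point only covers what lies to its right, so the base point moves
    with [x]. Subtracting the value at [0] makes the result independent of the base point, which is
    what [base] expresses. *)
Lemma antiderivative f : continuous f -> exists F, derivative F f.
Proof.
move=> fc.
have itg (a b : R) : (@lebesgue_measure R).-integrable `[a, b] (EFin \o f).
  apply: continuous_compact_integrable; first exact: segment_compact.
  exact: continuous_subspaceT.
pose I (a x : R) := (\int[@lebesgue_measure R]_(s in `[a, x]) f s)%R.
have I' (a x : R) : a < x -> is_derive x 1 (I a) (f x).
  move=> ax; have xu : x < x + 1 by rewrite ltrDl.
  have [d e] := continuous_FTC1_closed xu (itg _ _) ax (fc x).
  by split; [exact: d|rewrite -derive1E; exact: e].
have base (a b x y : R) : a <= b -> b < x -> b < y ->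
    I a y - I a x = I b y - I b x.
  move=> ab; wlog xy : x y / x < y => [hw bx by_|bx by_].
    case: (ltgtP x y) => [xy|yx|->]; [exact: hw| |by rewrite !subrr].
    by have := hw y x yx by_ bx; lra.
  have D z : b < z -> is_derive z 1 (fun s => I a s - I b s) 0.
    move=> bz; apply: is_derive_congr; first apply: is_derive_add.
    - exact: I' (le_lt_trans ab bz).
    - by apply: is_derive_opp; exact: I'.
    - by rewrite subrr.
  have [z||c _] := @MVT _ (fun s => I a s - I b s) (fun=> 0) _ _ xy.
  - by rewrite in_itv /= => /andP[xz _]; apply: D; exact: lt_trans xz.
  - apply: derivable_within_continuous => z; rewrite in_itv /= => /andP[xz _].
    by case: (D z (lt_le_trans bx xz)).
  - by rewrite mul0r; lra.
(* Locally around [x] the base point of the integral can be frozen. *)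
exists (fun x => I (- (`|x| + 1)) x - I (- (`|x| + 1)) 0) => x.
pose a := - (`|x| + 3); have ax : a < x by rewrite /a; have := ler_norm (- x); rewrite normrN; lra.
apply: (@near_eq_is_derive _ _ _ (fun s => I a s - I a 0)).
  have : \forall y \near x, `|x - y| < 1.
    exact: (@nbhsx_ballx _ _ x 1 ltr01).
  apply: filterS => y xy; apply: base.
  - rewrite /a lerN2; have := ler_normB x (x - y); rewrite opprB addrC subrK; lra.
  - by rewrite oppr_lt0; have := normr_ge0 y; lra.
  - by have := ler_norm (- y); rewrite normrN; lra.
by apply: is_derive_congr; [apply: is_derive_add; exact: I'|rewrite addr0].
Qed.

(** The derivative is quantified existentially at each order, so that every closure property below
    is one induction and no iterated derivative has to be computed. *)
Fixpoint Ck n f : Prop :=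
  if n is m.+1 then exists2 df, derivative f df & Ck m df else continuous f.

Definition cinf f := forall n, Ck n f.

Lemma CkW n f : Ck n.+1 f -> Ck n f.
Proof.
elim: n f => [|n IH] f [df F Cdf]; first exact: derivative_continuous F.
by exists df => //; exact: IH.
Qed.

Lemma CkD n f g : Ck n f -> Ck n g -> Ck n (fun t => f t + g t).
Proof.
elim: n f g => [f g fc gc t|n IH f g [df F Cf] [dg G Cg]].
  by apply: continuousD; [exact: fc|exact: gc].
by exists (fun t => df t + dg t); [move=> t; exact: is_derive_add|exact: IH].
Qed.

Lemma CkM n f g : Ck n f -> Ck n g -> Ck n (fun t => f t * g t).
Proof.
elim: n f g => [f g fc gc t|n IH f g Hf Hg].
  by apply: continuousM; [exact: fc|exact: gc].
have [df F Cf] := Hf; have [dg G Cg] := Hg.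
exists (fun t => df t * g t + f t * dg t); first by move=> t; exact: is_derive_mul.
by apply: CkD; apply: IH => //; exact: CkW.
Qed.

Lemma Ck_cst n (c : R) : Ck n (fun=> c).
Proof.
elim: n c => [c|n IH c]; first exact: cst_continuous.
by exists (fun=> 0) => // t; exact: is_derive_const.
Qed.

Lemma Ck_id n : Ck n (fun t => t).
Proof.
case: n => [t|n]; first exact: cvg_id.
by exists (fun=> 1); [move=> t; exact: is_derive_self|exact: Ck_cst].
Qed.

Lemma CkN n f : Ck n f -> Ck n (fun t => - f t).
Proof.
move=> Cf; have := CkM (Ck_cst n (-1)) Cf.
by congr Ck; apply/funext => t; rewrite mulN1r.
Qed.

Lemma Ck_inv n f : (forall t, f t != 0) -> Ck n f -> Ck n (fun t => (f t)^-1).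
Proof.
move=> f0; elim: n => [fc t|n IH Hf]; first by apply: continuousV => //; exact: fc.
have [df F Cf] := Hf; exists (fun t => - (df t / f t ^+ 2)).
  by move=> t; apply: is_derive_inv.
have V := IH (CkW Hf); apply: CkN; apply: CkM => //.
by have := CkM V V; congr Ck; apply/funext => t; rewrite -invfM -expr2.
Qed.

Lemma Ck_comp n f g : Ck n f -> Ck n g -> Ck n (fun t => f (g t)).
Proof.
elim: n f g => [f g fc gc t|n IH f g [df F Cf] Hg].
  by apply: (@continuous_comp _ _ _ g f); [exact: gc|exact: fc].
have [dg G Cg] := Hg; exists (fun t => df (g t) * dg t).
  by move=> t; exact: is_derive_compose.
by apply: CkM => //; apply: IH => //; exact: CkW.
Qed.

Lemma cinfD f g : cinf f -> cinf g -> cinf (fun t => f t + g t).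
Proof. by move=> F G n; exact: CkD. Qed.

Lemma cinfM f g : cinf f -> cinf g -> cinf (fun t => f t * g t).
Proof. by move=> F G n; exact: CkM. Qed.

Lemma cinfN f : cinf f -> cinf (fun t => - f t).
Proof. by move=> F n; exact: CkN. Qed.

Lemma cinfV f : (forall t, f t != 0) -> cinf f -> cinf (fun t => (f t)^-1).
Proof. by move=> f0 F n; exact: Ck_inv. Qed.

Lemma cinf_comp f g : cinf f -> cinf g -> cinf (fun t => f (g t)).
Proof. by move=> F G n; exact: Ck_comp. Qed.

Lemma cinf_cst (c : R) : cinf (fun=> c).
Proof. by move=> n; exact: Ck_cst. Qed.

Lemma cinf_id : cinf (fun t => t).
Proof. by move=> n; exact: Ck_id. Qed.

Lemma cinf_derivative f df : derivative f df -> cinf df -> cinf f.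
Proof.
by move=> F C [|n]; [exact: derivative_continuous F|exists df].
Qed.

Lemma cinf_derivableE f : cinf f -> exists2 df, derivative f df & cinf df.
Proof.
move=> C; have [df F _] := C 1; exists df => // n.
by have [dg G] := C n.+1; rewrite (derivative_unique F G).
Qed.

Lemma cinf_continuous f : cinf f -> continuous f.
Proof. by move=> C; exact: (C 0). Qed.

Lemma cinf_sin : cinf sin.
Proof.
suff H n : Ck n (@sin R) /\ Ck n (@cos R) by move=> n; case: (H n).
elim: n => [|n [IHs IHc]]; first by split; [exact: continuous_sin|exact: continuous_cos].
split; first by exists cos => //; move=> t; exact: is_derive_sin.
by exists (fun t => - sin t); [move=> t; exact: is_derive_cos|exact: CkN].
Qed.

Lemma cinf_cos : cinf cos.
Proof.
case=> [|n]; first exact: continuous_cos.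
by exists (fun t => - sin t); [move=> t; exact: is_derive_cos|apply: CkN; exact: cinf_sin].
Qed.

Lemma cinf_atan : cinf atan.
Proof.
apply: (@cinf_derivative _ (fun t => (1 + t * t)^-1)).
  by move=> t; rewrite -expr2; exact: is_derive1_atan.
apply: cinfV => [t|]; first by rewrite lt0r_neq0 // ltr_pwDl // -expr2 sqr_ge0.
by apply: cinfD; [exact: cinf_cst|apply: cinfM; exact: cinf_id].
Qed.

(** Bootstrapping: the derivative of [g] is built from [df] and [g] itself, so each order of
    regularity of [g] gives the next one. *)
Lemma cinf_inverse f g df : cinf f -> derivative f df -> (forall t, df t != 0) ->
  derivative g (fun y => (df (g y))^-1) -> cinf g.
Proof.
move=> Cf F p G.
have Cdf : cinf df by have [dg] := cinf_derivableE Cf; move/(derivative_unique F) <-.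
elim=> [|n IH]; first exact: derivative_continuous G.
exists (fun y => (df (g y))^-1) => //.
by apply: Ck_inv => //; apply: Ck_comp => //; exact: Cdf.
Qed.

End Calculus2.

Ltac cinf_step := lazymatch goal with
  | |- cinf (fun s => s) => apply: cinf_id
  | |- cinf (fun s => @?f s + @?g s) => apply: cinfD
  | |- cinf (fun s => - @?f s) => apply: cinfN
  | |- cinf (fun s => @?f s * @?g s) => apply: cinfM
  | |- cinf (fun s => (@?f s) ^+ 2) => apply: cinfM
  | |- cinf (fun s => sin (@?f s)) => apply: (cinf_comp cinf_sin)
  | |- cinf (fun s => cos (@?f s)) => apply: (cinf_comp cinf_cos)
  | |- cinf (fun s => atan (@?f s)) => apply: (cinf_comp cinf_atan)
  | |- cinf ( *%R ?c) => apply: (cinfM (f := fun=> c) (g := fun s => s))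
  | |- cinf (+%R ?c) => apply: (cinfD (f := fun=> c) (g := fun s => s))
  | |- cinf -%R => apply: (cinfN (f := fun s => s))
  | |- cinf sin => exact: cinf_sin
  | |- cinf cos => exact: cinf_cos
  | H : cinf ?f |- cinf ?f => exact: H
  | H : cinf ?f |- cinf (fun s => ?f s) => exact: H
  | H : cinf ?f |- cinf (fun s => ?f (@?g s)) => apply: (cinf_comp H)
  | |- _ => apply: cinf_cst
  end.
Ltac cinf_tac := repeat cinf_step.

(** * Angles *)

Section Angles.
Context {R : realType}.
Implicit Types (x y t : R).

Lemma twopi_gt0 : 0 < 2 * pi :> R.
Proof. by rewrite mulr_gt0 // pi_gt0. Qed.

Lemma periodic_int (T : Type) (f : R -> T) (c : R) : (forall t, f (t + c) = f t) ->
  forall (k : int) t, f (t + k%:~R * c) = f t.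
Proof.
move=> per.
have pn (n : nat) t : f (t + n%:R * c) = f t.
  elim: n t => [|n IH] t; first by rewrite mul0r addr0.
  by rewrite -natr1 mulrDl mul1r addrA per IH.
case=> n t; first exact: pn.
by rewrite NegzE mulrNz mulNr -(pn n.+1 (t - _)) subrK.
Qed.

Lemma cos_add2pi t : cos (t + 2 * pi) = cos t.
Proof. by rewrite mulr_natl cosD2pi. Qed.

Lemma sin_add2pi t : sin (t + 2 * pi) = sin t.
Proof. by rewrite mulr_natl sinD2pi. Qed.

Lemma cos_addpi t : cos (t + pi) = - cos t. Proof. exact: cosDpi. Qed.

Lemma sin_addpi t : sin (t + pi) = - sin t. Proof. exact: sinDpi. Qed.

Lemma reduce_angle (a x : R) : exists (k : int) y,
  x = y + k%:~R * (2 * pi) /\ a <= y < a + 2 * pi.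
Proof.
have p := twopi_gt0; pose k := Num.floor ((x - a) / (2 * pi)).
have := floor_le ((x - a) / (2 * pi)); have := floorD1_gt ((x - a) / (2 * pi)).
rewrite -/k intrD mulr1z ler_pdivlMr // ltr_pdivrMr // mulrDl mul1r => h1 h2.
exists k, (x - k%:~R * (2 * pi)); split; first by rewrite subrK.
by move: h1 h2; set K := k%:~R * _; lra.
Qed.

Lemma sin_eq0 x : sin x = 0 ->
  exists k : int, x = k%:~R * (2 * pi) \/ x = pi + k%:~R * (2 * pi).
Proof.
have [k [y [-> /andP[y0 y2]]]] := reduce_angle 0 x.
rewrite (periodic_int sin_add2pi) => sy; exists k; case: (ltgtP y pi) => [yp|py|->].
- left; move: y0; rewrite le_eqVlt => /orP[/eqP<-|y0]; first by rewrite add0r.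
  by have := @sin_gt0_pi _ y; rewrite y0 yp sy ltxx => /(_ isT).
- have := @sin_gt0_pi _ (y - pi); rewrite subr_gt0 py /=.
  have -> : y - pi < pi by lra.
  by rewrite -[y in sin y = 0](subrK pi) sin_addpi in sy; move/eqP: sy; rewrite oppr_eq0 => /eqP-> /(_ isT); rewrite ltxx.
- by right.
Qed.

Lemma polar x y : x ^+ 2 + y ^+ 2 = 1 -> exists t, cos t = x /\ sin t = y.
Proof.
move=> e; have x1 : -1 <= x <= 1 by apply/andP; split; nra.
have c : cos (acos x) = x by rewrite acosK.
have s : sin (acos x) = `|y|.
  by rewrite sin_acos // (_ : 1 - x ^+ 2 = y ^+ 2) ?sqrtr_sqr //; lra.
case: (leP 0 y) => y0; [exists (acos x)|exists (- acos x)].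
  by rewrite c s ger0_norm.
by rewrite cosN sinN c s ltr0_norm // opprK.
Qed.

Lemma cos2pi_eq1 x : cos x = 1 -> exists k : int, x = k%:~R * (2 * pi).
Proof.
move=> c; have s : sin x = 0 by have := cos2Dsin2 x; rewrite c; nra.
have [k [->|E]] := sin_eq0 s; first by exists k.
by move: c; rewrite E (periodic_int cos_add2pi) cospi; lra.
Qed.

End Angles.

(** * A smooth angle for a plane vector that never vanishes *)

Section Lift.
Context {R : realType}.
Implicit Types (x y t : R).

(** A pointwise choice of the angle would jump, so the angle is defined by integrating the
    derivative that it must have. The last two conclusions say that [(z1, z2)] is a positive
    multiple of [tau (psi t)]: for a velocity vector, [psi] is the angle of the normal. *)
Lemma angle_lift (z1 z2 dz1 dz2 : R -> R) :
  cinf z1 -> cinf z2 -> derivative z1 dz1 -> derivative z2 dz2 ->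
  (forall t, z1 t * z1 t + z2 t * z2 t != 0) ->
  exists psi, [/\ cinf psi,
    derivative psi (fun t => (z1 t * dz2 t - z2 t * dz1 t) * (z1 t * z1 t + z2 t * z2 t)^-1),
    forall t, z1 t * cos (psi t) + z2 t * sin (psi t) = 0 &
    forall t, 0 < z2 t * cos (psi t) - z1 t * sin (psi t)].
Proof.
move=> C1 C2 D1 D2 N0.
set N := fun t => z1 t * z1 t + z2 t * z2 t; set k := fun t => _ * _.
have Cd1 : cinf dz1 by have [d /(derivative_unique D1) ->] := cinf_derivableE C1.
have Cd2 : cinf dz2 by have [d /(derivative_unique D2) ->] := cinf_derivableE C2.
have Ck : cinf k by apply: cinfM; [|apply: cinfV => //]; cinf_tac.
have [F F'] := antiderivative (cinf_continuous Ck).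
have Np t : 0 < N t by rewrite lt_def N0 /= addr_ge0 // -expr2 sqr_ge0.
(* The initial angle is chosen so that the vector at [0] equals [Num.sqrt (N 0)] times [tau a0]. *)
have [a0 [ca sa]] : exists a, cos a = z2 0 / Num.sqrt (N 0) /\ sin a = - z1 0 / Num.sqrt (N 0).
  apply: polar; rewrite !exprMn sqrrN -mulrDl exprVn sqr_sqrtr ?ltW //.
  by rewrite addrC -!/(_ ^+ 2) /N -!expr2 divff // expr2.
pose psi t := F t - F 0 + a0.
have D : derivative psi k by move=> t; rewrite /psi; derive_tac; ring.
exists psi; have s2c2 t : sin (psi t) ^+ 2 = 1 - cos (psi t) ^+ 2 by rewrite sin2cos2.
pose c t := z1 t * cos (psi t) + z2 t * sin (psi t).
pose s t := z2 t * cos (psi t) - z1 t * sin (psi t).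
have cs t : c t * c t + s t * s t = N t.
  by have := s2c2 t; rewrite /c /s /N; nra.
pose g t := (z1 t * dz1 t + z2 t * dz2 t) * (N t)^-1.
have Dc : derivative c (fun t => g t * c t).
  move=> t; rewrite /c; derive_tac; rewrite /g /k /c /=.
  have := N0 t; rewrite -/(N t) /N; move: (sin _) (cos _) => S C.
  by move=> NE; field.
have DN : derivative N (fun t => 2 * (g t * N t)).
  by move=> t; rewrite {1}/N; derive_tac; rewrite /= /g divfK; [ring|exact: N0].
(* [c] and [N] have logarithmic derivatives [g] and [2 g]. *)
have Dq : derivative (fun t => c t * c t * (N t)^-1) (fun=> 0).
  move=> u; apply: is_derive_congr.
    by apply: is_derive_mul; [apply: is_derive_mul; exact: Dc|apply: is_derive_inv; [exact: N0|exact: DN]].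
  by rewrite /=; have := N0 u; rewrite -/(N u); move: (c u) (g u) (N u) => *; field.
have c0 t : c t = 0.
  have := derivative_cst Dq t 0; rewrite /= (_ : c 0 = 0) ?mul0r.
    by move/eqP; rewrite !mulf_eq0 invr_eq0 (negPf (N0 t)) orbF orbb => /eqP.
  rewrite /c /psi subrr add0r ca sa; ring.
split=> //.
  exact: cinf_derivative D Ck.
have Cpsi : cinf psi := cinf_derivative D Ck.
apply: (@continuous_sign _ s 0) => [|t|].
- by rewrite /s; apply: cinf_continuous; cinf_tac.
- by apply/eqP => s0; have := cs t; rewrite c0 s0 !mul0r addr0 => /esym/eqP; rewrite (negPf (N0 t)).
- rewrite /s /psi subrr add0r ca sa.
  rewrite [X in 0 < X](_ : _ = N 0 / Num.sqrt (N 0)); last by rewrite /N; ring.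
  by rewrite divr_gt0 // sqrtr_gt0.
Qed.

End Lift.

Section QuasiPeriodic.
Context {R : realType}.
Implicit Types (f : R -> R) (c t : R).

Lemma quasi_periodic_int f c : (forall t, f (t + c) = f t + c) ->
  forall (k : int) t, f (t + k%:~R * c) = f t + k%:~R * c.
Proof.
move=> per k t; have h u : f (u + c) - (u + c) = f u - u by rewrite per; ring.
by have := periodic_int h k t; move/eqP; rewrite subr_eq => /eqP->; ring.
Qed.

Lemma quasi_periodic_surj f c : 0 < c -> continuous f ->
  (forall t, f (t + c) = f t + c) -> forall y, exists x, f x = y.
Proof.
move=> c0 fc per y; pose k := Num.floor ((y - f 0) / c).
have := floor_le ((y - f 0) / c); have := floorD1_gt ((y - f 0) / c).
rewrite -/k ler_pdivlMr // ltr_pdivrMr // => h1 h2.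
have le01 : k%:~R * c <= (k + 1)%:~R * c by rewrite ler_pM2r // ler_int lerDl.
have E (j : int) : f (j%:~R * c) = f 0 + j%:~R * c by rewrite -[in LHS](add0r (_ * c)) quasi_periodic_int.
have [||x _ xy] := @IVT R f (k%:~R * c) ((k + 1)%:~R * c) y le01; last by exists x.
  exact: continuous_subspaceT.
rewrite !E ge_min le_max; move: h1 h2; set u := k%:~R * c; set v := (k + 1)%:~R * c => h1 h2.
have {}h1 : y <= f 0 + v by rewrite addrC -lerBlDr ltW.
by have {}h2 : f 0 + u <= y; [rewrite addrC -lerBrDr|rewrite h2 h1 orbT].
Qed.

End QuasiPeriodic.

(** * Plane curves through their coordinates *)

Section Components.
Context {R : realType}.
Implicit Types (g : R -> R * R) (t : R) (l : R * R).

Lemma is_derive_fst g t l :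
  is_derive t 1 g l -> is_derive t 1 (fun s => (g s).1) l.1.
Proof.
case=> dg <-.
have dg' : h^-1 *: ((g \o shift t) (h *: 1) - g t) @[h --> 0^'] --> 'D_1 g t.
  exact: dg.
have c1 : (fst \o (fun h => h^-1 *: ((g \o shift t) (h *: 1) - g t))) h
    @[h --> 0^'] --> ('D_1 g t).1.
  by apply: (cvg_comp _ _ dg'); exact: cvg_fst.
have c2 : h^-1 *: (((fun s => (g s).1) \o shift t) (h *: 1) - (g t).1)
    @[h --> 0^'] --> ('D_1 g t).1.
  exact: c1.
split; first by apply/cvg_ex; exists ('D_1 g t).1; exact: c2.
exact: (cvg_lim (@norm_hausdorff _ _) c2).
Qed.

Lemma is_derive_snd g t l :
  is_derive t 1 g l -> is_derive t 1 (fun s => (g s).2) l.2.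
Proof.
case=> dg <-.
have dg' : h^-1 *: ((g \o shift t) (h *: 1) - g t) @[h --> 0^'] --> 'D_1 g t.
  exact: dg.
have c1 : (snd \o (fun h => h^-1 *: ((g \o shift t) (h *: 1) - g t))) h
    @[h --> 0^'] --> ('D_1 g t).2.
  by apply: (cvg_comp _ _ dg'); exact: cvg_snd.
have c2 : h^-1 *: (((fun s => (g s).2) \o shift t) (h *: 1) - (g t).2)
    @[h --> 0^'] --> ('D_1 g t).2.
  exact: c1.
split; first by apply/cvg_ex; exists ('D_1 g t).2; exact: c2.
exact: (cvg_lim (@norm_hausdorff _ _) c2).
Qed.

Lemma is_derive_pair (f1 f2 : R -> R) t (a b : R) :
  is_derive t 1 f1 a -> is_derive t 1 f2 b ->
  is_derive t 1 (fun s => (f1 s, f2 s)) (a, b).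
Proof.
case=> df1 <- [df2 <-].
have c1 : h^-1 *: ((f1 \o shift t) (h *: 1) - f1 t) @[h --> 0^'] --> 'D_1 f1 t.
  exact: df1.
have c2 : h^-1 *: ((f2 \o shift t) (h *: 1) - f2 t) @[h --> 0^'] --> 'D_1 f2 t.
  exact: df2.
have c : (h^-1 *: ((f1 \o shift t) (h *: 1) - f1 t),
          h^-1 *: ((f2 \o shift t) (h *: 1) - f2 t))
    @[h --> 0^'] --> ('D_1 f1 t, 'D_1 f2 t).
  exact: cvg_pair c1 c2.
have c3 : h^-1 *: (((fun s => (f1 s, f2 s)) \o shift t) (h *: 1) - (f1 t, f2 t))
    @[h --> 0^'] --> ('D_1 f1 t, 'D_1 f2 t).
  exact: c.
split; first by apply/cvg_ex; exists ('D_1 f1 t, 'D_1 f2 t); exact: c3.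
exact: (cvg_lim (@norm_hausdorff _ _) c3).
Qed.

Lemma smooth_cinf g : smooth g ->
  [/\ cinf (fun t => (g t).1), cinf (fun t => (g t).2),
      derivative (fun t => (g t).1) (fun t => (derive1 g t).1) &
      derivative (fun t => (g t).2) (fun t => (derive1 g t).2)].
Proof.
move=> sg.
have D k t : is_derive t 1 (derive1n k g) (derive1n k.+1 g t).
  by rewrite derive1nS derive1E; split=> //; exact: sg.
suff H n k : Ck n (fun t => (derive1n k g t).1) /\ Ck n (fun t => (derive1n k g t).2).
  split=> [n|n|t|t]; [exact: (H n 0).1|exact: (H n 0).2| |].
    exact: (is_derive_fst (D 0 t)).
  exact: (is_derive_snd (D 0 t)).
elim: n k => [k|n IH k].
  split; apply: derivative_continuous => t.
    exact: (is_derive_fst (D k t)).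
  exact: (is_derive_snd (D k t)).
split.
  exists (fun t => (derive1n k.+1 g t).1); last exact: (IH k.+1).1.
  by move=> t; exact: is_derive_fst (D k t).
exists (fun t => (derive1n k.+1 g t).2); last exact: (IH k.+1).2.
by move=> t; exact: is_derive_snd (D k t).
Qed.

Lemma smooth_components g : smooth g -> exists g1 g2 : R -> R,
  [/\ cinf g1, cinf g2 & g = fun t => (g1 t, g2 t)].
Proof.
move=> /smooth_cinf [c1 c2 _ _].
exists (fun t => (g t).1), (fun t => (g t).2); split=> //.
by apply/funext => t; rewrite -surjective_pairing.
Qed.

Lemma derive1_pair (f1 f2 d1 d2 : R -> R) :
  derivative f1 d1 -> derivative f2 d2 ->
  derive1 (fun t => (f1 t, f2 t)) = fun t => (d1 t, d2 t).
Proof.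
move=> F1 F2; apply/funext => t; rewrite derive1E.
by have [_ ->] := is_derive_pair (F1 t) (F2 t).
Qed.

End Components.

(** * Parametrization by the angle of the normal *)

(* [(X t, Y t)] is the point of the curve with outward normal [normal t], and
   [rho] is the radius of curvature. *)
Record normal_param {R : realType} (g : R -> R * R) (X Y rho : R -> R) : Prop :=
NormalParam {
  np_X : derivative X (fun t => - (rho t * sin t));
  np_Y : derivative Y (fun t => rho t * cos t);
  np_cX : cinf X;
  np_cY : cinf Y;
  np_crho : cinf rho;
  np_rho_gt0 : forall t, 0 < rho t;
  np_perX : forall t, X (t + 2 * pi) = X t;
  np_perY : forall t, Y (t + 2 * pi) = Y t;
  np_range : forall z, range g z <-> exists t, z = (X t, Y t);
  np_tangents : forall x y, parallel_tangents g x y <->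
    exists a b, [/\ x = (X a, Y a), y = (X b, Y b) & sin (b - a) = 0]
}.

Section Reparam.
Context {R : realType}.
Implicit Types (t : R).

(** Positive curvature makes the normal angle [psi] strictly increasing, and strict convexity makes
    it gain exactly one turn per period. Then [psi] is a bijection of the real line, and its inverse
    [T] is the change of parameter. *)
Lemma oval_normal_param (g : R -> R * R) : oval g ->
  exists X Y rho, normal_param g X Y rho.
Proof.
move=> og.
have [g1 [g2 [c1 c2 gE]]] := smooth_components (oval_smooth og).
have [d1 D1 Cd1] := cinf_derivableE c1; have [d2 D2 Cd2] := cinf_derivableE c2.
have [dd1 DD1 Cdd1] := cinf_derivableE Cd1; have [dd2 DD2 Cdd2] := cinf_derivableE Cd2.
have g'E : derive1 g = fun t => (d1 t, d2 t) by rewrite gE; exact: derive1_pair.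
have g''E : derive1 (derive1 g) = fun t => (dd1 t, dd2 t).
  by rewrite g'E; exact: derive1_pair.
have crossE t u : cross (derive1 g t) u = d1 t * u.2 - d2 t * u.1 by rewrite g'E.
have N0 t : d1 t * d1 t + d2 t * d2 t != 0.
  apply/eqP => h; have /eqP := oval_regular og t; apply; rewrite g'E.
  have -> : d1 t = 0 by nra.
  by have -> : d2 t = 0 by nra.
have cr t : 0 < d1 t * dd2 t - d2 t * dd1 t.
  have := oval_curvature og t; rewrite /curvature crossE derive1nS derive1n1 g''E /=.
  rewrite ltNge => /negP h; rewrite ltNge; apply/negP => h'.
  by apply: h; rewrite mulr_le0_ge0 // invr_ge0 exprn_ge0 // sqrtr_ge0.
have per t : g1 (t + 2 * pi) = g1 t /\ g2 (t + 2 * pi) = g2 t.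
  by have := oval_closed og t; rewrite gE => -[-> ->].
have [psi [Cpsi Dpsi psi_n psi_t]] := angle_lift Cd1 Cd2 DD1 DD2 N0.
set k := fun t => _ in Dpsi.
pose s t := d2 t * cos (psi t) - d1 t * sin (psi t).
have Np t : 0 < d1 t * d1 t + d2 t * d2 t.
  by rewrite lt_def N0 -!expr2 addr_ge0 // sqr_ge0.
have kp t : 0 < k t by rewrite /k mulr_gt0 // invr_gt0.
have rot (a b S C : R) : a * C + b * S = 0 -> C ^+ 2 + S ^+ 2 = 1 ->
    a = - ((b * C - a * S) * S) /\ b = (b * C - a * S) * C.
  move=> p q; split; apply/eqP; rewrite -subr_eq0; apply/eqP.
    transitivity (C * (a * C + b * S) + a * (1 - (C ^+ 2 + S ^+ 2))); first ring.
    by rewrite p q; ring.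
  transitivity (S * (a * C + b * S) + b * (1 - (C ^+ 2 + S ^+ 2))); first ring.
  by rewrite p q; ring.
have d1E t : d1 t = - (s t * sin (psi t)).
  by have [] := rot _ _ _ _ (psi_n t) (cos2Dsin2 (psi t)).
have d2E t : d2 t = s t * cos (psi t).
  by have [] := rot _ _ _ _ (psi_n t) (cos2Dsin2 (psi t)).
have sp t : 0 < s t by exact: psi_t.
have s2 t : s t ^+ 2 = d1 t * d1 t + d2 t * d2 t.
  have := cos2Dsin2 (psi t); rewrite d1E d2E => h; rewrite -[LHS]mulr1 -h; ring.
have psi_incr := derivative_incr Dpsi kp.
have per1 t : d1 (t + 2 * pi) = d1 t.
  by apply: (derivative_periodic D1) => u; case: (per u).
have per2 t : d2 (t + 2 * pi) = d2 t.
  by apply: (derivative_periodic D2) => u; case: (per u).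
have perd1 t : dd1 (t + 2 * pi) = dd1 t by exact: (derivative_periodic DD1).
have perd2 t : dd2 (t + 2 * pi) = dd2 t by exact: (derivative_periodic DD2).
pose c := psi (2 * pi) - psi 0.
have psi_c t : psi (t + 2 * pi) = psi t + c.
  have D : derivative (fun t => psi (t + 2 * pi) - psi t) (fun=> 0).
    move=> u; derive_tac; rewrite /k per1 per2 perd1 perd2; ring.
  have := derivative_cst D t 0; rewrite add0r -/c; lra.
have c0 : 0 < c by rewrite subr_gt0 (leW_mono psi_incr) twopi_gt0.
have sper t : s (t + 2 * pi) = s t.
  have := s2 (t + 2 * pi); rewrite per1 per2 -s2 => /eqP.
  by rewrite eqrXn2 ?ltW // => /eqP.
(* The velocity and its length have the same values at both ends of a period, hence so do the cosine
   and sine of [psi]: the increment [c] is a whole number of turns. *)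
have [m cE] : exists m : int, c = m%:~R * (2 * pi).
  apply: cos2pi_eq1; rewrite (_ : c = psi (0 + 2 * pi) - psi 0); last by rewrite psi_c; ring.
  have := per1 0; have := per2 0; rewrite cosB !d1E !d2E sper => /(mulfI (lt0r_neq0 (sp 0))) ->.
  by move/oppr_inj/(mulfI (lt0r_neq0 (sp 0))) ->; rewrite -!expr2 cos2Dsin2.
have m1 : m = 1.
  have m0 : 0 < m by rewrite -(ltr0z R) -(pmulr_lgt0 _ twopi_gt0) -cE.
  apply/eqP; rewrite eq_le -gtz0_ge1 m0 andbT leNgt; apply/negP => m2.
  have m2' : 2 * (2 * pi) <= c.
    by rewrite cE ler_pM2r ?twopi_gt0 // (_ : 2 = 2%:~R) // ler_int; lia.
  (* A second full turn of the tangent would give two points with the same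
     oriented tangent direction, each strictly to the left of the other. *)
  have [||t tI tE] := @IVT R psi 0 (2 * pi) (psi 0 + 2 * pi) (ltW twopi_gt0).
  - exact: derivative_within_continuous Dpsi.
  - by rewrite ge_min le_max; have := @twopi_gt0 R; move: m2'; rewrite /c; lra.
  have := tI; rewrite in_itv /= => /andP[t0 t2].
  have p2 := @twopi_gt0 R.
  have t0' : t != 0 by apply/eqP => e; move: tE; rewrite e; lra.
  have t2' : t != 2 * pi by apply/eqP => e; move: tE m2'; rewrite e /c; lra.
  have ne : g t <> g 0.
    move=> e; move/eqP: t0'; apply; apply: (oval_simple og _ _ e).
      by rewrite t0 lt_neqAle t2' t2.
    by rewrite lexx.
  have left u v : g u <> g v ->
      0 < - (sin (psi v) * (g2 u - g2 v) + cos (psi v) * (g1 u - g1 v)).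
    move=> /(oval_strictly_convex og); rewrite crossE gE /= d1E d2E => h.
    rewrite -(pmulr_rgt0 _ (sp v)); apply: lt_le_trans h _.
    by rewrite le_eqVlt; apply/orP; left; apply/eqP; ring.
  have := left _ _ ne; have := left _ _ (fun e => ne (esym e)).
  by rewrite tE cos_add2pi sin_add2pi; lra.
have psi_c2 t : psi (t + 2 * pi) = psi t + 2 * pi by rewrite psi_c cE m1 mul1r.
have surj := quasi_periodic_surj twopi_gt0 (cinf_continuous Cpsi) psi_c2.
have [T [psiK TK] DT] := derivative_inverse Dpsi kp surj.
have k0 t : k t != 0 by rewrite lt0r_neq0.
have CT : cinf T := cinf_inverse Cpsi Dpsi k0 DT.
have T2 a : T (a + 2 * pi) = T a + 2 * pi by apply: (can_inj psiK); rewrite TK psi_c2 TK.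
(* The radius of curvature is the speed [s] divided by the rate of turning [k]. *)
exists (fun a => g1 (T a)), (fun a => g2 (T a)), (fun a => s (T a) * (k (T a))^-1).
split.
- by move=> a; derive_tac; rewrite d1E TK; ring.
- by move=> a; derive_tac; rewrite d2E TK; ring.
- by cinf_tac.
- by cinf_tac.
- have [k' /(derivative_unique Dpsi) <- Ck] := cinf_derivableE Cpsi.
  apply: cinfM; first by rewrite /s; cinf_tac.
  by apply: cinfV; [move=> a; exact: k0|cinf_tac].
- by move=> a; rewrite divr_gt0.
- by move=> a; rewrite T2; case: (per (T a)).
- by move=> a; rewrite T2; case: (per (T a)).
- move=> z; split=> [[t _ <-]|[a ->]]; last first.
    by exists (T a) => //; rewrite gE.
  by exists (psi t); rewrite psiK gE.
- move=> x y; split=> [[t [u [<- <- e]]]|[a [b [-> -> e]]]].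
    exists (psi t), (psi u); rewrite !psiK gE; split=> //.
    move: e; rewrite !crossE ?g'E /= !d1E !d2E => e.
    have : s t * s u * sin (psi u - psi t) = 0 by rewrite sinB -e; ring.
    by move/eqP; rewrite !mulf_eq0 !(negPf (lt0r_neq0 (sp _))) /= => /eqP.
  exists (T a), (T b); split; [by rewrite gE|by rewrite gE|].
  rewrite !crossE ?g'E /= !d1E !d2E !TK.
  transitivity (s (T a) * s (T b) * sin (b - a)); first by rewrite sinB; ring.
  by rewrite e mulr0.
Qed.
End Reparam.

(** * Support function and interior *)

Section Support.
Context {R : realType}.
Context (g : R -> R * R) (X Y rho : R -> R) (NP : normal_param g X Y rho).
Implicit Types (a b t : R) (z : R * R) (k : int).

Let DX := np_X NP.
Let DY := np_Y NP.
Let rho_gt0 := np_rho_gt0 NP.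

(* [ndot] and [tdot] are the scalar products with [normal a] and [tau a]. *)
Definition ndot a u v : R := cos a * u + sin a * v.
Definition tdot a u v : R := cos a * v - sin a * u.

Definition supp a : R := ndot a (X a) (Y a).

Definition body : set (R * R) := [set z | forall a, ndot a z.1 z.2 < supp a].

Lemma periodicX k t : X (t + k%:~R * (2 * pi)) = X t.
Proof. by apply: periodic_int; exact: np_perX NP. Qed.

Lemma periodicY k t : Y (t + k%:~R * (2 * pi)) = Y t.
Proof. by apply: periodic_int; exact: np_perY NP. Qed.

(** Along the curve the projection to [normal a] has derivative [- (rho t * sin (t - a))]. It falls
    during the half turn after [a] and rises back during the next one, so within a period it is
    maximal at [a] alone. *)
Lemma supp_lt a b : a < b < a + 2 * pi -> ndot a (X b) (Y b) < supp a.
Proof.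
move=> /andP[ab b2]; have p0 := @pi_gt0 R.
pose f t := cos a * X t + sin a * Y t.
have Df : derivative f (fun t => - (rho t * sin (t - a))).
  by move=> t; rewrite /f; derive_tac; rewrite sinB /=; ring.
have DNf : derivative (fun t => - f t) (fun t => rho t * sin (t - a)).
  by move=> t; derive_tac; rewrite opprK.
rewrite -[_ < _]/(f b < f a); case: (leP b (a + pi)) => bp.
  rewrite -ltrN2; apply: (derivative_lt DNf ab) => t /andP[t1 t2].
  by rewrite mulr_gt0 // sin_gt0_pi //; apply/andP; split; lra.
have -> : f a = f (a + 2 * pi) by rewrite /f (np_perX NP) (np_perY NP).
apply: (derivative_lt Df b2) => t /andP[t1 t2].
rewrite -mulrN mulr_gt0 // (_ : t - a = t - a - pi + pi) ?sin_addpi ?opprK; last by rewrite subrK.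
by rewrite sin_gt0_pi //; apply/andP; split; lra.
Qed.

Lemma supp_lt_neq a b : (X b, Y b) <> (X a, Y a) -> ndot a (X b) (Y b) < supp a.
Proof.
move=> ne; have [k [c [bE /andP[ac c2]]]] := reduce_angle a b.
move: ne; rewrite bE periodicX periodicY => ne; apply: supp_lt.
rewrite c2 andbT lt_neqAle ac andbT; apply/eqP => e; apply: ne.
by rewrite e.
Qed.

Lemma supp_ge a b : ndot a (X b) (Y b) <= supp a.
Proof.
have [[-> ->]|/eqP ne] := eqVneq (X b, Y b) (X a, Y a); first exact: lexx.
exact/ltW/supp_lt_neq.
Qed.

Lemma normal_param_inj a b : (X a, Y a) = (X b, Y b) ->
  exists k, b = a + k%:~R * (2 * pi).
Proof.
move=> [e1 e2]; have [k [c [bE /andP[ac c2]]]] := reduce_angle a b.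
exists k; move: e1 e2; rewrite bE periodicX periodicY => e1 e2.
move: ac; rewrite le_eqVlt => /orP[/eqP->//|ac].
by have := @supp_lt a c; rewrite ac c2 /supp e1 e2 ltxx => /(_ isT).
Qed.

Lemma derivative_supp : derivative supp (fun a => tdot a (X a) (Y a)).
Proof.
move=> a; rewrite /supp /ndot /tdot; derive_tac.
by rewrite /=; ring.
Qed.

Lemma derivative_ndot u v : derivative (fun a => ndot a u v) (fun a => tdot a u v).
Proof. by move=> a; rewrite /ndot /tdot; derive_tac; rewrite /=; ring. Qed.

Lemma supp_periodic a : supp (a + 2 * pi) = supp a.
Proof. by rewrite /supp /ndot (np_perX NP) (np_perY NP) cos_add2pi sin_add2pi. Qed.

Lemma ndot_periodic a u v : ndot (a + 2 * pi) u v = ndot a u v.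
Proof. by rewrite /ndot cos_add2pi sin_add2pi. Qed.

Lemma ndot_tdot a u v u' v' :
  ndot a u v = ndot a u' v' -> tdot a u v = tdot a u' v' -> (u, v) = (u', v').
Proof.
rewrite /ndot /tdot => e1 e2; have h := cos2Dsin2 a.
have E (x y : R) : x = cos a * ndot a x y - sin a * tdot a x y /\
    y = sin a * ndot a x y + cos a * tdot a x y.
  by rewrite /ndot /tdot; split; rewrite -[LHS]mul1r -h; ring.
have [Eu Ev] := E u v; have [Eu' Ev'] := E u' v'.
by congr (_, _); [rewrite Eu Eu'|rewrite Ev Ev']; rewrite /ndot /tdot e1 e2.
Qed.

(** The gap [supp b - ndot b z.1 z.2] is minimal at [b = a], so its derivative vanishes there too.
    Value and derivative fix both coordinates of [z] in the frame [normal a], [tau a]. *)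
Lemma touching_point z a : (forall b, ndot b z.1 z.2 <= supp b) ->
  ndot a z.1 z.2 = supp a -> z = (X a, Y a).
Proof.
move=> le_z ea; pose f b := supp b - ndot b z.1 z.2.
have Df : derivative f (fun b => tdot b (X b) (Y b) - tdot b z.1 z.2).
  by move=> b; exact: is_derive_add (derivative_supp b) (is_derive_opp (derivative_ndot _ _ b)).
have : is_derive a 1 f 0.
  apply: (@derive1_at_min _ f (a - 1) (a + 1)) => [|t _||t _].
  - lra.
  - by case: (Df t).
  - by rewrite in_itv /=; apply/andP; split; lra.
  - by rewrite /f ea subrr subr_ge0.
move/(is_derive_unique (Df a)) => /eqP; rewrite subr_eq0 => /eqP e.
by rewrite [LHS]surjective_pairing; apply: (ndot_tdot ea); rewrite e.
Qed.

Lemma ndot_continuous a : continuous (fun z : R * R => ndot a z.1 z.2).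
Proof.
move=> z; rewrite /ndot; apply: cvgD; apply: cvgM; try exact: cvg_cst.
  exact: cvg_fst.
exact: cvg_snd.
Qed.

(** By periodicity a compact interval of directions suffices, and the continuous gap attains its
    minimum there. The uniform margin serves both openness and measurability of [body]. *)
Lemma body_gap z : body z -> exists2 d, 0 < d & forall a, ndot a z.1 z.2 + d <= supp a.
Proof.
move=> Kz; pose f b := supp b - ndot b z.1 z.2.
have Df : derivative f (fun b => tdot b (X b) (Y b) - tdot b z.1 z.2).
  by move=> b; exact: is_derive_add (derivative_supp b) (is_derive_opp (derivative_ndot _ _ b)).
have [c cI cmin] := EVT_min (ltW (@twopi_gt0 R)) (derivative_within_continuous (a := 0) (b := 2 * pi) Df).
exists (f c) => [|a]; first by rewrite subr_gt0.
have [k [b [-> /andP[b0 b2]]]] := reduce_angle 0 a.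
rewrite (periodic_int supp_periodic) /ndot (periodic_int cos_add2pi) (periodic_int sin_add2pi).
rewrite addrC -lerBrDr; apply: cmin; rewrite in_itv /= b0 ltW //; lra.
Qed.

Lemma open_body : open body.
Proof.
rewrite openE => z /body_gap [d d0 gap]; apply/nbhs_ballP.
exists (d / 2); first by rewrite /= divr_gt0.
move=> y [/= y1 y2] a; apply: lt_le_trans (gap a); rewrite -ltrBlDl.
have c1 := cos_max a; have s1 := sin_max a.
rewrite /ndot; have -> : cos a * y.1 + sin a * y.2 - (cos a * z.1 + sin a * z.2) =
  cos a * (y.1 - z.1) + sin a * (y.2 - z.2) by ring.
have : `|cos a * (y.1 - z.1)| < d / 2.
  rewrite normrM; apply: le_lt_trans y1; rewrite distrC -[leRHS]mul1r.
  exact: ler_wpM2r.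
have : `|sin a * (y.2 - z.2)| < d / 2.
  rewrite normrM; apply: le_lt_trans y2; rewrite distrC -[leRHS]mul1r.
  exact: ler_wpM2r.
by rewrite !ltr_norml => /andP[_ h1] /andP[_ h2]; lra.
Qed.

Lemma body_range z : body z -> ~ range g z.
Proof.
move=> Kz /(np_range NP) [t e]; have := Kz t.
by rewrite e /= ltxx.
Qed.

Lemma closed_halfplanes : closed [set z | forall a, ndot a z.1 z.2 <= supp a].
Proof.
rewrite (_ : mkset _ = \bigcap_(a in setT) [set z | ndot a z.1 z.2 <= supp a]).
  apply: closed_bigI => a _.
  apply: (@closed_comp _ _ (fun z : R * R => ndot a z.1 z.2) [set x | x <= supp a]).
    by move=> z _; exact: ndot_continuous.
  exact: closed_le.
by apply/seteqP; split=> z h a; [move=> _; exact: h|exact: (h a I)].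
Qed.

Lemma body_bounded : exists M, forall z, body z -> `|z.1| <= M /\ `|z.2| <= M.
Proof.
exists (`|supp 0| + `|supp pi| + `|supp (pi / 2)| + `|supp (pi / 2 + pi)|) => z Kz.
have := Kz 0; have := Kz pi; have := Kz (pi / 2); have := Kz (pi / 2 + pi).
rewrite /ndot cos0 sin0 cospi sinpi cos_addpi sin_addpi cos_pihalf sin_pihalf.
have := ler_norm (supp 0); have := ler_norm (supp pi).
have := ler_norm (supp (pi / 2)); have := ler_norm (supp (pi / 2 + pi)).
have := normr_ge0 (supp 0); have := normr_ge0 (supp pi).
have := normr_ge0 (supp (pi / 2)); have := normr_ge0 (supp (pi / 2 + pi)).
by rewrite !ler_norml => *; split; apply/andP; split; lra.
Qed.

(** A point off the curve that violates the inequality for some [a] starts a ray along [normal a]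
    that misses the curve, so its component is unbounded. Conversely [body] is open, and also closed
    relative to the complement of the curve by [touching_point]; hence the component of one of its
    points stays in this bounded set. *)
Lemma inside_body : inside g = body.
Proof.
apply/seteqP; split=> [z [nz bz] a|z Kz].
  rewrite ltNge; apply/negP => le_a.
  pose ray := (fun s : R => (z.1 + s * cos a, z.2 + s * sin a)) @` `[0, +oo[.
  have ray_sub : ray `<=` ~` range g.
    move=> _ [s s0 <-] /(np_range NP) [t [e1 e2]].
    move: s0; rewrite /= in_itv /= andbT le_eqVlt => /orP[/eqP s0|s0].
      apply: nz; apply/(np_range NP); exists t; rewrite -e1 -e2 -s0 !mul0r !addr0.
      exact: surjective_pairing.
    have := supp_ge a t; rewrite -e1 -e2 => h.
    have : ndot a z.1 z.2 + s <= supp a.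
      apply: le_trans h; rewrite /ndot le_eqVlt; apply/orP; left; apply/eqP.
      by rewrite -[s in LHS]mulr1 -(cos2Dsin2 a); ring.
    lra.
  have ray_z : ray z.
    exists 0; first by rewrite /= in_itv /= lexx.
    by rewrite !mul0r !addr0 -surjective_pairing.
  have lc (u v : R) : continuous (fun s : R => u + s * v).
    by apply: cinf_continuous; cinf_tac.
  have ray_conn : connected ray.
    apply: connected_continuous_connected.
      exact/connected_intervalP/interval_is_interval.
    apply: continuous_subspaceT => s.
    apply: (@cvg_pair _ _ _ _ (nbhs (z.1 + s * cos a)) (nbhs (z.2 + s * sin a))).
      exact: (lc z.1 (cos a) s).
    exact: (lc z.2 (sin a) s).
  have := connected_component_max ray_z ray_sub ray_conn => sub.
  have [M [_ HM]] := bz; pose N := `|M| + 1.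
  have bN y : ray y -> `|y.1| <= N /\ `|y.2| <= N.
    move=> /sub /(HM N) h; have {}h : `|y| <= N by apply: h; rewrite /N; have := ler_norm M; lra.
    by move: h; rewrite prod_normE ge_max => /andP[].
  (* So far along the ray that the projection to [normal a] exceeds [2 * N], its bound on the square
     of half-side [N] that contains the component. *)
  pose s := 2 * N + `|ndot a z.1 z.2| + 1.
  have N0 : 0 <= N by rewrite /N; have := normr_ge0 M; lra.
  have s0 : 0 <= s by rewrite /s; have := normr_ge0 (ndot a z.1 z.2); lra.
  have rs : ray (z.1 + s * cos a, z.2 + s * sin a).
    by exists s => //; rewrite /= in_itv /= s0.
  have prodN (c y : R) : `|c| <= 1 -> `|y| <= N -> c * y <= N.
    move=> c1 yN; apply: le_trans (ler_norm _) _; rewrite normrM -[leRHS]mul1r.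
    exact: ler_pM.
  have [/= /(prodN _ _ (cos_max a)) h1 /(prodN _ _ (sin_max a)) h2] := bN _ rs.
  have : ndot a z.1 z.2 + s <= 2 * N.
    have -> : ndot a z.1 z.2 + s = cos a * (z.1 + s * cos a) + sin a * (z.2 + s * sin a).
      by rewrite /ndot -[s in LHS]mulr1 -(cos2Dsin2 a); ring.
    lra.
  rewrite /s; have := ler_norm (- ndot a z.1 z.2); rewrite normrN; lra.
have nz := body_range Kz; split=> //.
set C := connected_component _ _.
have CK : C `&` body = C.
  apply: (@component_connected _ (~` range g) z); rewrite -/C.
  - by exists z; split=> //; exact: connected_component_refl.
  - by exists body => //; exact: open_body.
  - exists [set z | forall a, ndot a z.1 z.2 <= supp a]; first exact: closed_halfplanes.
    apply/seteqP; split=> y [Cy hy]; split=> // a; first exact/ltW/hy.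
    rewrite lt_neqAle hy andbT; apply/eqP => e.
    apply: (connected_component_sub Cy); apply/(np_range NP).
    by exists a; exact: touching_point.
have [M HM] := body_bounded.
exists M; split; first by rewrite num_real.
move=> N MN y Cy; have [_ /HM [h1 h2]] : (C `&` body) y by rewrite CK.
suff h : `|y| <= N by exact: h.
by rewrite prod_normE ge_max (le_trans h1 (ltW MN)) (le_trans h2 (ltW MN)).
Qed.

End Support.

(** * The circumscribed hexagon and the Blaschke-Lebesgue inequality *)

Section Trig.
Context {R : realType}.

Lemma cos_pi3 : cos (pi / 3) = 1 / 2 :> R.
Proof.
have p0 := @pi_gt0 R; set x := pi / 3.
have s0 : 0 < sin x by apply: sin_gt0_pi; rewrite /x; apply/andP; split; lra.
have : sin (x + x) = sin x.
  rewrite -[RHS]opprK -sinN -sin_addpi; congr sin; rewrite /x; lra.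
rewrite sinD => h; have : sin x * (2 * cos x - 1) = 0 by lra.
by move/eqP; rewrite mulf_eq0 (gt_eqF s0) /= => /eqP; lra.
Qed.

Lemma sin_pi3_gt0 : 0 < sin (pi / 3) :> R.
Proof. by have p0 := @pi_gt0 R; apply: sin_gt0_pi; apply/andP; split; lra. Qed.

Lemma sin_pi3 : sin (pi / 3) = Num.sqrt 3 / 2 :> R.
Proof.
apply/eqP; rewrite -(@eqrXn2 _ 2) ?ltW ?sin_pi3_gt0 ?divr_gt0 ?sqrtr_gt0 //.
apply/eqP; rewrite exprMn sqr_sqrtr // sin2cos2 cos_pi3; lra.
Qed.

Lemma cos_2pi3 : cos (pi / 3 + pi / 3) = - (1 / 2) :> R.
Proof.
by rewrite cosD -expr2 -expr2 sin2cos2 cos_pi3; lra.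
Qed.

Lemma sin_2pi3 : sin (pi / 3 + pi / 3) = sin (pi / 3) :> R.
Proof. by rewrite sinD cos_pi3; lra. Qed.

(** The form equals [b ^+ 2 - a * (b - a)], which on this sector reaches [W ^+ 2] only for [b = W]
    with [a = 0] or [a = W]. These are two vertices of the hexagon, and the two disjunctions exclude
    them. *)
Lemma hexagon_sector (W a b : R) : 0 <= a -> a <= b -> b <= W ->
  a < W \/ b < W -> b < W \/ b - a < W -> a ^+ 2 - a * b + b ^+ 2 < W ^+ 2.
Proof.
move=> a0 ab bW o1 o2; have [bW'|Wb] := ltP b W; first by nra.
have {Wb}E : b = W by lra.
by case: o1 => o1; case: o2 => o2; subst b; try lra; nra.
Qed.

(* The six sign patterns of [a], [b] and [b - a] are permuted by the symmetries
   of the hexagon [|a|, |b|, |b - a| <= W]. *)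
Lemma hexagon_strict (W a b : R) :
  a <= W -> b <= W -> b - a <= W -> - a <= W -> - b <= W -> a - b <= W ->
  a < W \/ b < W -> b < W \/ b - a < W -> b - a < W \/ - a < W ->
  - a < W \/ - b < W -> - b < W \/ a - b < W -> a - b < W \/ a < W ->
  a ^+ 2 - a * b + b ^+ 2 < W ^+ 2.
Proof.
move=> h1 h2 h3 h4 h5 h6 p1 p2 p3 p4 p5 p6.
have Qe (x y : R) : x ^+ 2 - x * y + y ^+ 2 = a ^+ 2 - a * b + b ^+ 2 ->
    x ^+ 2 - x * y + y ^+ 2 < W ^+ 2 -> a ^+ 2 - a * b + b ^+ 2 < W ^+ 2.
  by move->.
case: (leP 0 a) => a0; case: (leP 0 b) => b0; case: (leP a b) => ab; try lra.
- exact: hexagon_sector.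
- apply: (Qe b a); first ring.
  by apply: hexagon_sector => //; [lra|tauto|tauto].
- apply: (Qe a (a - b)); first ring.
  by apply: hexagon_sector => //; [lra|tauto|rewrite (_ : a - b - a = - b); [tauto|ring]].
- apply: (Qe b (b - a)); first ring.
  by apply: hexagon_sector => //; [lra|rewrite (_ : b - a - b = - a); [tauto|ring]].
- apply: (Qe (- b) (- a)); first ring.
  apply: hexagon_sector => //; [lra|lra|tauto|].
  by rewrite (_ : - a - - b = b - a); [tauto|ring].
- apply: (Qe (- a) (- b)); first ring.
  apply: hexagon_sector => //; [lra|lra|].
  by rewrite (_ : - b - - a = a - b); [tauto|ring].
Qed.

End Trig.

Section ConstantWidth.
Context {R : realType}.
Context (g : R -> R * R) (X Y rho : R -> R) (NP : normal_param g X Y rho).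
Implicit Types (a b t : R) (z : R * R).
Local Notation hsupp := (supp X Y).

Lemma sup_maximum (A : set R) m : A m -> (forall x, A x -> x <= m) -> sup A = m.
Proof.
move=> Am mA; apply/eqP; rewrite eq_le; apply/andP; split.
  by apply: ge_sup; [exists m|].
by apply: ub_le_sup => //; exists m.
Qed.

Lemma ndot_addpi a u v : ndot (a + pi) u v = - ndot a u v.
Proof. by rewrite /ndot cos_addpi sin_addpi; ring. Qed.

Lemma tdot_addpi a u v : tdot (a + pi) u v = - tdot a u v.
Proof. by rewrite /tdot cos_addpi sin_addpi; ring. Qed.

Lemma width_supp t : width g t = hsupp t + hsupp (t + pi).
Proof.
have rg z : range g z -> forall a, ndot a z.1 z.2 <= hsupp a.
  by move=> /(np_range NP) [s ->] a; exact: supp_ge NP _ _.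
have gr s : range g (X s, Y s) by apply/(np_range NP); exists s.
rewrite /width; congr (_ + _).
  apply: sup_maximum; first by exists (X t, Y t).
  by move=> _ [z /rg h <-]; exact: h.
rewrite /inf opprK; apply: sup_maximum.
  exists (dot (normal t) (X (t + pi), Y (t + pi))); first by exists (X (t + pi), Y (t + pi)).
  by rewrite /supp ndot_addpi.
by move=> _ [_ [z /rg h <-] <-]; have := h (t + pi); rewrite ndot_addpi.
Qed.

Context (w : R) (hw : constant_width g w).

Lemma supp_antipode t : hsupp (t + pi) = w - hsupp t.
Proof. by rewrite -(hw t) width_supp; ring. Qed.

(** Differentiate [supp_antipode] twice and use that [rho] is the support function plus its second
    derivative. *)
Lemma rho_antipode t : rho (t + pi) = w - rho t.
Proof.
have D := derivative_supp NP.
have DX := np_X NP; have DY := np_Y NP.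
have D2 : derivative (fun a => tdot a (X a) (Y a)) (fun a => rho a - hsupp a).
  move=> a; rewrite /tdot /supp /ndot; derive_tac.
  by rewrite /= -[rho a in RHS]mul1r -(cos2Dsin2 a); ring.
have E : (fun t => hsupp (t + pi)) = (fun t => w - hsupp t) by apply/funext => u; exact: supp_antipode.
have D1 := derivative_shift pi D; rewrite E in D1.
have D1' : derivative (fun t => w - hsupp t) (fun t => - tdot t (X t) (Y t)).
  by move=> u; derive_tac; rewrite add0r.
have E2 := derivative_unique D1 D1'.
have D3 := derivative_shift pi D2; rewrite /= E2 in D3.
have D3' : derivative (fun a => - tdot a (X a) (Y a)) (fun a => - (rho a - hsupp a)).
  by move=> u; derive_tac.
have := congr1 (fun f => f t) (derivative_unique D3 D3').
by rewrite /= supp_antipode; lra.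
Qed.

Lemma width_gt0 : 0 < w.
Proof.
have := @supp_lt _ _ _ _ _ NP 0 pi; rewrite pi_gt0 add0r /= -(hw 0) width_supp add0r.
have p0 := @pi_gt0 R.
have -> : pi < 2 * pi :> R by lra.
have -> : hsupp pi = - ndot 0 (X pi) (Y pi) by rewrite -ndot_addpi add0r.
by move/(_ isT); lra.
Qed.

(** The mid-lines of the strips at [t], [t + pi / 3] and [t + 2 * pi / 3] have offsets given by [c].
    The middle normal is the sum of the other two, so the lines concur exactly when [f t = 0].
    Rotation by [pi / 3] changes the sign of [f], whence a zero. *)
Lemma hexagon_center : exists o1 o2 t0 : R, forall k : nat,
  hsupp (t0 + k%:R * (pi / 3)) - ndot (t0 + k%:R * (pi / 3)) o1 o2 = w / 2.
Proof.
pose c t := hsupp t - w / 2.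
have cp t : c (t + pi) = - c t by rewrite /c supp_antipode; lra.
pose f t := c t - c (t + pi / 3) + c (t + pi / 3 + pi / 3).
have fp t : f (t + pi / 3) = - f t.
  rewrite /f (_ : t + pi / 3 + pi / 3 + pi / 3 = t + pi); last by field.
  by rewrite cp; lra.
have p0 := @pi_gt0 R; have p3 : 0 <= pi / 3 :> R by lra.
have [||t0 _ f0] := @IVT R f 0 (pi / 3) 0 p3.
- apply: continuous_subspaceT.
  have C : cinf hsupp.
    have cX := np_cX NP; have cY := np_cY NP.
    by rewrite /supp /ndot; cinf_tac.
  by apply: cinf_continuous; rewrite /f /c; cinf_tac.
- rewrite -[pi / 3]add0r fp ge_min le_max.
  by case: (leP (f 0) 0) => h; rewrite ?oppr_ge0 ?oppr_le0 ?h ?(ltW h) ?orbT.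
pose t1 := t0 + pi / 3; pose t2 := t1 + pi / 3.
have c1 : c t1 = c t0 + c t2 by move: f0; rewrite /f -/t1 -/t2; lra.
(* In the frame at [t0] the centre has coordinates [c t0] and [s]; the value of [s] puts it on the
   mid-line at [t1], and [c1] then puts it on the third one. *)
pose s := (c t1 - c t0 / 2) / sin (pi / 3).
pose o1 := cos t0 * c t0 - sin t0 * s; pose o2 := sin t0 * c t0 + cos t0 * s.
have q0 : sin (pi / 3) != 0 :> R by rewrite lt0r_neq0 // sin_pi3_gt0.
have sq : s * sin (pi / 3) = c t1 - c t0 / 2 by rewrite /s divfK.
have n0 : ndot t0 o1 o2 = c t0.
  by rewrite /ndot /o1 /o2 -[RHS]mul1r -(cos2Dsin2 t0); ring.
have m0 : tdot t0 o1 o2 = s.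
  by rewrite /tdot /o1 /o2 -[RHS]mul1r -(cos2Dsin2 t0); ring.
have rot a b : ndot (a + b) o1 o2 = cos b * ndot a o1 o2 + sin b * tdot a o1 o2.
  by rewrite /ndot /tdot cosD sinD; ring.
have n1 : ndot t1 o1 o2 = c t1.
  by rewrite /t1 rot n0 m0 cos_pi3 [X in _ + X]mulrC sq; field.
have n2 : ndot t2 o1 o2 = c t2.
  by have := rot t0 (pi / 3 + pi / 3); rewrite addrA -/t1 -/t2 => ->; rewrite n0 m0 cos_2pi3 sin_2pi3 [X in _ + X]mulrC sq c1; lra.
exists o1, o2, t0.
(* Three more steps of [pi / 3] make a half turn, which constant width controls, so the three angles
   treated above suffice. *)
suff H (k : nat) : forall j : nat, (j < 3)%N ->
    hsupp (t0 + (k * 3 + j)%:R * (pi / 3)) - ndot (t0 + (k * 3 + j)%:R * (pi / 3)) o1 o2 = w / 2.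
  by move=> k; rewrite (divn_eq k 3); apply: H; rewrite ltn_mod.
elim: k => [|k IH] j j3.
  rewrite mul0n add0n; case: j j3 => [|[|[|//]]] _.
  - by rewrite mul0r addr0 n0 /c; lra.
  - by rewrite mul1r -/t1 n1 /c; lra.
  - by rewrite (_ : t0 + 2 * (pi / 3) = t2) ?n2 /c; [lra|rewrite /t2 /t1; lra].
rewrite (_ : t0 + _ = t0 + (k * 3 + j)%:R * (pi / 3) + pi).
  by rewrite supp_antipode ndot_addpi; have := IH j j3; lra.
by rewrite mulSn !natrD; field.
Qed.

Section Hexagon.
Context (o1 o2 t0 : R).
Context (hexE : forall k : nat,
  hsupp (t0 + k%:R * (pi / 3)) - ndot (t0 + k%:R * (pi / 3)) o1 o2 = w / 2).

Let U t := X t - o1.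
Let V t := Y t - o2.
(** This is an angle: that of the normal to the [k]-th side of the hexagon. The vertices of the
    hexagon belong to the sextants between consecutive values. *)
Let vertex k := t0 + k%:R * (pi / 3).

Let vertexS k : vertex k.+1 = vertex k + pi / 3.
Proof. by rewrite /vertex -natr1; ring. Qed.

Lemma hexagon_le k t : ndot (vertex k) (U t) (V t) <= w / 2.
Proof.
rewrite -(hexE k) lerBrDr; apply: le_trans (supp_ge NP (vertex k) t).
by rewrite /ndot /U /V le_eqVlt; apply/orP; left; apply/eqP; ring.
Qed.

Lemma hexagon_lt k t : ndot (vertex k) (U t) (V t) < w / 2 \/
  ndot (vertex k.+1) (U t) (V t) < w / 2.
Proof.
have E j : ndot (vertex j) (U t) (V t) = ndot (vertex j) (X t) (Y t) - ndot (vertex j) o1 o2.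
  by rewrite /ndot /U /V; ring.
have str j : (X t, Y t) <> (X (vertex j), Y (vertex j)) ->
    ndot (vertex j) (U t) (V t) < w / 2.
  by move=> ne; rewrite E -(hexE j) ltrD2r; exact: (supp_lt_neq NP).
have [[e1 e2]|/eqP ne] := eqVneq (X t, Y t) (X (vertex k), Y (vertex k)); last by left; apply: str.
right; apply: str; rewrite e1 e2 => -[e3 e4].
have p0 := @pi_gt0 R.
have := @supp_lt _ _ _ _ _ NP (vertex k) (vertex k.+1).
rewrite -e3 -e4 ltxx vertexS; suff -> : vertex k < vertex k + pi / 3 < vertex k + 2 * pi.
  by move/(_ isT).
by apply/andP; split; lra.
Qed.

(** The disc through the vertices of the hexagon has squared radius [w ^+ 2 / 3]. The curve avoids
    the vertices, and being compact it keeps a positive distance from that circle. *)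
Lemma circumradius : exists2 r, r < w ^+ 2 / 3 & forall t, U t ^+ 2 + V t ^+ 2 <= r.
Proof.
have lt t : U t ^+ 2 + V t ^+ 2 < w ^+ 2 / 3.
  have := hexagon_le ^~ t; have := hexagon_lt ^~ t.
  set u := U t; set v := V t => lt_ le_.
  pose a := ndot (vertex 0) u v; pose b := ndot (vertex 1) u v.
  pose m := tdot (vertex 0) u v.
  have rot x y : ndot (x + y) u v = cos y * ndot x u v + sin y * tdot x u v.
    by rewrite /ndot /tdot cosD sinD; ring.
  have bE : b = a / 2 + sin (pi / 3) * m.
    by rewrite /b vertexS rot cos_pi3 /a /m; lra.
  have cE : ndot (vertex 2) u v = b - a.
    by rewrite !vertexS -addrA rot cos_2pi3 sin_2pi3 bE /a /m; lra.
  have opp k : ndot (vertex (3 + k)) u v = - ndot (vertex k) u v.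
    by rewrite -ndot_addpi; congr ndot; rewrite /vertex natrD; field.
  (* The squared distance to the centre in the oblique coordinates [a], [b] along two side normals
     at an angle of [pi / 3]; the factor is [1 / sin (pi / 3) ^+ 2]. *)
  have Q : u ^+ 2 + v ^+ 2 = 4 / 3 * (a ^+ 2 - a * b + b ^+ 2).
    transitivity (a ^+ 2 + m ^+ 2).
      rewrite -[LHS]mul1r -(cos2Dsin2 (vertex 0)) /a /m /ndot /tdot; ring.
    have q2 : sin (pi / 3) ^+ 2 = 3 / 4 :> R by rewrite sin2cos2 cos_pi3; lra.
    rewrite bE; transitivity (a ^+ 2 + 4 / 3 * sin (pi / 3) ^+ 2 * m ^+ 2).
      by rewrite q2; field.
    by field.
  suff : a ^+ 2 - a * b + b ^+ 2 < (w / 2) ^+ 2.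
    by rewrite Q; have := width_gt0; nra.
  have := le_ 0%N; have := le_ 1%N; have := le_ 2%N; have := le_ 3%N; have := le_ 4%N; have := le_ 5%N.
  have := lt_ 0%N; have := lt_ 1%N; have := lt_ 2%N; have := lt_ 3%N; have := lt_ 4%N; have := lt_ 5%N.
  rewrite (opp 0%N) (opp 1%N) (opp 2%N) (opp 3%N) (opp 0%N) !cE -/a -/b opprK opprB.
  by move=> *; apply: hexagon_strict.
have cX := np_cX NP; have cY := np_cY NP.
pose f t := U t ^+ 2 + V t ^+ 2.
have fc : continuous f by apply: cinf_continuous; rewrite /f /U /V; cinf_tac.
have [c _ cmax] := EVT_max (ltW (@twopi_gt0 R)) (@continuous_subspaceT _ _ `[0, 2 * pi] _ fc).
exists (f c) => [|t]; first exact: lt.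
have [k [b [-> /andP[b0 b2]]]] := reduce_angle 0 t.
rewrite /U /V (periodicX NP) (periodicY NP); apply: (cmax b).
by rewrite in_itv /= b0; lra.
Qed.

Let h t := ndot t (U t) (V t).
Let dh t := tdot t (U t) (V t).

Let hE t : h t = hsupp t - ndot t o1 o2.
Proof. by rewrite /h /supp /ndot /U /V; ring. Qed.

Let h_vertex k : h (vertex k) = w / 2.
Proof. by rewrite hE hexE. Qed.

Let h_antipode t : h (t + pi) = w - h t.
Proof. by rewrite !hE supp_antipode ndot_addpi; ring. Qed.

Let Dh : derivative h dh.
Proof.
have DX := np_X NP; have DY := np_Y NP => t.
by rewrite /h /dh /ndot /tdot /U /V; derive_tac; rewrite /=; ring.
Qed.

Let Ddh : derivative dh (fun t => rho t - h t).
Proof.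
have DX := np_X NP; have DY := np_Y NP => t.
rewrite /h /dh /ndot /tdot /U /V; derive_tac.
by rewrite /= -[rho t in RHS]mul1r -(cos2Dsin2 t); ring.
Qed.

(* The right-hand side is the support function of the hexagon on a sextant. *)
Lemma supp_sextant k x : 0 <= x <= pi / 3 ->
  h (vertex k + x) <= w / 2 * (cos x + sin x / Num.sqrt 3).
Proof.
move=> /andP[x0 x3]; set q := Num.sqrt 3.
have q0 : 0 < q :> R by rewrite sqrtr_gt0.
have p0 := @pi_gt0 R.
have s0 : 0 <= sin x by apply: sin_ge0_pi; apply/andP; split; lra.
have s1 : 0 <= q / 2 * cos x - sin x / 2.
  have : 0 <= sin (pi / 3 - x) by apply: sin_ge0_pi; apply/andP; split; lra.
  by rewrite sinB sin_pi3 cos_pi3 -/q; lra.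
set u := U (vertex k + x); set v := V (vertex k + x).
have a := hexagon_le k (vertex k + x); have b := hexagon_le k.+1 (vertex k + x).
rewrite vertexS -/u -/v in a b.
(* The normal at [vertex k + x] is a combination of the two adjacent side normals with weights
   proportional to [sin (pi / 3 - x)] and [sin x], both nonnegative on the sextant. *)
have E : h (vertex k + x) * (q / 2) = (q / 2 * cos x - sin x / 2) * ndot (vertex k) u v
    + sin x * ndot (vertex k + pi / 3) u v.
  rewrite /h -/u -/v /ndot !cosD !sinD sin_pi3 cos_pi3 -/q; ring.
have q2 : 0 < q / 2 by rewrite divr_gt0.
rewrite -(ler_pM2r q2) E.
apply: (@le_trans _ _ ((q / 2 * cos x - sin x / 2) * (w / 2) + sin x * (w / 2))).
  by apply: lerD; apply: ler_wpM2l.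
rewrite le_eqVlt; apply/orP; left; apply/eqP; field.
by rewrite lt0r_neq0.
Qed.

(* [h t = w - h (t + pi)] is bounded below with [supp_sextant], and
   [cos (t - b) * rho] and [sin (t - b) * rho] have antiderivatives in terms of
   [h] and [dh] because [rho = h + h'']. *)
Lemma sextant_area (M P : R -> R) k :
  derivative M (fun t => h t * rho t) -> derivative P rho ->
  w * (P (vertex k.+1) - P (vertex k)) - w / 2 * (dh (vertex k.+1) - dh (vertex k) + w / Num.sqrt 3)
  <= M (vertex k.+1) - M (vertex k).
Proof.
move=> DM DP; set b := vertex k; set q := Num.sqrt 3.
have q0 : 0 < q :> R by rewrite sqrtr_gt0.
have p0 := @pi_gt0 R.
pose N t := w * P t - w / 2 * (cos (t - b) * dh t + sin (t - b) * h t
   + (sin (t - b) * dh t - cos (t - b) * h t) / q).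
have DN : derivative N (fun t => (w - w / 2 * (cos (t - b) + sin (t - b) / q)) * rho t).
  by move=> t; rewrite /N; derive_tac; rewrite /=; field; rewrite lt0r_neq0.
have D : derivative (fun t => M t - N t)
    (fun t => h t * rho t - (w - w / 2 * (cos (t - b) + sin (t - b) / q)) * rho t).
  by move=> t; derive_tac.
have bS : vertex k.+1 = b + pi / 3 by rewrite vertexS.
have := @derivative_le _ _ _ b (vertex k.+1) D.
have -> : b <= vertex k.+1 by rewrite bS; lra.
have inc t : b < t < vertex k.+1 ->
    0 <= h t * rho t - (w - w / 2 * (cos (t - b) + sin (t - b) / q)) * rho t.
  move=> /andP[bt tb]; rewrite -mulrBl mulr_ge0 //; last exact/ltW/(np_rho_gt0 NP).
  (* Three sextants further on lies the antipodal sextant, which contains [t + pi]. *)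
  have := @supp_sextant (3 + k) (t - b).
  have -> : 0 <= t - b <= pi / 3 by rewrite bS in tb; apply/andP; split; lra.
  move/(_ isT); have -> : vertex (3 + k) + (t - b) = t + pi.
    by rewrite /b /vertex natrD; field.
  by rewrite h_antipode -/q; lra.
move=> /(_ isT inc); rewrite /N.
have hb : h b = w / 2 := h_vertex k.
have hb' := h_vertex k.+1.
have -> : vertex k.+1 - b = pi / 3 by rewrite bS; ring.
rewrite subrr cos0 sin0 hb hb' cos_pi3 sin_pi3 -/q.
have qq : q * q = 3 by rewrite -expr2 sqr_sqrtr.
set d1 := dh (vertex k.+1); set d0 := dh b.
have -> : (q / 2 * d1 - 1 / 2 * (w / 2)) / q = d1 / 2 - w / q / 4.
  by field; rewrite lt0r_neq0.
have -> : (0 * d0 - 1 * (w / 2)) / q = - (w / q / 2).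
  by field; rewrite lt0r_neq0.
have -> : q / 2 * (w / 2) = 3 * (w / q) / 4.
  by rewrite -qq; field; rewrite lt0r_neq0.
by move: (w / q) (P _) (P _) (M _) (M _) d0 d1 => *; lra.
Qed.

(** By Green's formula [S (2 * pi) - S 0] is the area enclosed, as the integrand is [- Y] times the
    derivative of [X]. The integral of [h * rho] is twice this area, and the six sextants bound it
    from below. *)
Lemma blaschke_lebesgue S : derivative S (fun t => Y t * (rho t * sin t)) ->
  (pi - Num.sqrt 3) / 2 * w ^+ 2 <= S (2 * pi) - S 0.
Proof.
move=> DS; have DX := np_X NP; have DY := np_Y NP.
have cX := np_cX NP; have cY := np_cY NP; have crho := np_crho NP.
have ch : continuous (fun t => h t * rho t).
  by apply: cinf_continuous; rewrite /h /ndot /U /V; cinf_tac.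
have [M DM] := antiderivative ch.
have [P DP] := antiderivative (cinf_continuous crho).
(* Since [h * rho] is [U] times the derivative of [Y] minus [V] times that of [X], integration by
   parts leaves only periodic terms. *)
have MS t : M t - 2 * S t - U t * V t - 2 * o2 * X t = M 0 - 2 * S 0 - U 0 * V 0 - 2 * o2 * X 0.
  apply: (@derivative_cst _ (fun t => M t - 2 * S t - U t * V t - 2 * o2 * X t)) => u.
  by rewrite /U /V; derive_tac; rewrite /= /h /ndot /U /V; ring.
have M2 : M (2 * pi) - M 0 = 2 * (S (2 * pi) - S 0).
  have := np_perX NP 0; have := np_perY NP 0; rewrite add0r => pY pX.
  by have := MS (2 * pi); rewrite /U /V pX pY; lra.
have Mper t : M (t + 2 * pi) - M t = M (2 * pi) - M 0.
  rewrite -[in M (2 * pi)](add0r (2 * pi)).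
  apply: (@derivative_cst _ (fun t => M (t + 2 * pi) - M t)) => u.
  have rper : rho (u + 2 * pi) = rho u.
    by rewrite (_ : u + 2 * pi = u + pi + pi) ?rho_antipode; [ring|ring].
  derive_tac; rewrite /h ndot_periodic /U /V (np_perX NP) (np_perY NP) rper; ring.
have Pper t : P (t + 2 * pi) - P t = pi * w.
  have D : derivative (fun t => P (t + pi) + P t - w * t) (fun=> 0).
    by move=> u; derive_tac; rewrite rho_antipode; ring.
  have := derivative_cst D t (t + pi).
  by rewrite (_ : t + pi + pi = t + 2 * pi); [lra|lra].
have v6 : vertex 6 = vertex 0 + 2 * pi by rewrite /vertex; field.
have q0 : 0 < Num.sqrt 3 :> R by rewrite sqrtr_gt0.
have dh6 : dh (vertex 6) = dh (vertex 0).
  by rewrite v6 /dh /tdot cos_add2pi sin_add2pi /U /V (np_perX NP) (np_perY NP).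
(* Over a period [rho] integrates to [pi * w], the increments of [dh] telescope to [0], and each
   sextant contributes one [w / Num.sqrt 3]. *)
have key : w * (pi * w) - w / 2 * (6 * (w / Num.sqrt 3)) <= M (2 * pi) - M 0.
  rewrite -(Mper (vertex 0)) -(Pper (vertex 0)) -v6.
  have := sextant_area 0 DM DP; have := sextant_area 1 DM DP; have := sextant_area 2 DM DP.
  have := sextant_area 3 DM DP; have := sextant_area 4 DM DP; have := sextant_area 5 DM DP.
  rewrite dh6.
  move: (w / Num.sqrt 3) (vertex 0) (vertex 1) (vertex 2) (vertex 3) (vertex 4) (vertex 5) (vertex 6).
  by move=> *; lra.
have qq : Num.sqrt 3 * Num.sqrt 3 = 3 :> R by rewrite -expr2 sqr_sqrtr.
have E : w / 2 * (6 * (w / Num.sqrt 3)) = Num.sqrt 3 * w ^+ 2.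
  rewrite (_ : 6 = 2 * (Num.sqrt 3 * Num.sqrt 3)); last by rewrite qq; ring.
  by field; rewrite lt0r_neq0.
by move: key; rewrite E M2; lra.
Qed.

End Hexagon.

End ConstantWidth.

(** * Area *)

Section Area.
Context {R : realType}.
Context (g : R -> R * R) (X Y rho : R -> R) (NP : normal_param g X Y rho).
Implicit Types (a b t x y : R).
Local Notation mu := (@lebesgue_measure R).
Local Notation plane := (measurableTypeR R * measurableTypeR R)%type.

Lemma measurable_halfplane (a c : R) :
  measurable ([set z | ndot a z.1 z.2 <= c] : set plane).
Proof.
have mf : measurable_fun setT (fun z : plane => ndot a z.1 z.2 : measurableTypeR R).
  apply: measurable_funD; apply: measurable_funM; try exact: measurable_cst.
    exact: measurable_fst.
  exact: measurable_snd.
have := mf measurableT `]-oo, c]%classic (measurable_itv _); rewrite setTI.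
by congr measurable; apply/seteqP; split=> z /=; rewrite in_itv.
Qed.

(** Rational angles make the intersection countable. They only give weak inequalities at the other
    angles, so a margin [n.+1%:R^-1], available by [body_gap], preserves strictness. The default
    value in [q] merely repeats the angle [0]. *)
Lemma measurable_body : measurable (body X Y : set plane).
Proof.
pose q n : R := ratr (odflt 0 (unpickle n : option rat)).
have -> : body X Y = \bigcup_n \bigcap_m
    [set z | ndot (q m) z.1 z.2 <= supp X Y (q m) - n.+1%:R^-1].
  apply/seteqP; split=> [z /(body_gap NP) [d d0 gap]|z [n _ h] a].
    have [n nd] : exists n : nat, n.+1%:R^-1 < d.
      by have [n _ /(_ n (leqnn n)) h] := near_infty_natSinv_lt (PosNum d0); exists n.
    by exists n => // m _ /=; rewrite lerBrDr; apply: le_trans (gap (q m)); rewrite lerD2l ltW.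
  rewrite ltNge; apply/negP => le_a.
  have e0 : 0 < n.+1%:R^-1 :> R by [].
  move: (n.+1%:R^-1) e0 h => e e0 h.
  pose f b := supp X Y b - ndot b z.1 z.2 - e.
  have fc : continuous f.
    apply: cinf_continuous; have cX := np_cX NP; have cY := np_cY NP.
    by rewrite /f /supp /ndot; cinf_tac.
  have [x [fp [r _ rE]]] : ([set b | f b < 0] `&` (@ratr R @` setT)) !=set0.
    apply: dense_rat; first by exists a; rewrite /= /f; lra.
    apply: (@open_comp _ _ f [set x | x < 0]); last exact: open_lt.
    by move=> b _; exact: fc.
  have := h (pickle r) I; rewrite /= /q pickleK /= rE.
  by move: fp; rewrite /= /f -rE; lra.
apply: bigcup_measurable => n _; apply: bigcapT_measurable => m.
exact: measurable_halfplane.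
Qed.

Local Open Scope ereal_scope.

(** [planar_area] applies [fine], which sends [+oo] to [0]; a lower bound for the area therefore
    requires finiteness. *)
Lemma body_area_fin : (mu \x mu) (body X Y : set plane) < +oo.
Proof.
have [M HM] := body_bounded X Y.
apply: (@le_lt_trans _ _ ((mu \x mu) (`[(- M)%R, M] `*` `[(- M)%R, M] : set plane))).
  apply: le_measure; rewrite ?inE; [exact: measurable_body| |].
    by apply: measurableX; exact: measurable_itv.
  by move=> z /HM [h1 h2]; split; rewrite /= in_itv /= -ler_norml.
rewrite product_measure1E; try exact: measurable_itv.
rewrite -[X in X < _]/(mu _ * mu _) lebesgue_measure_itv /=.
by case: ifP => _; rewrite ?mule0 ?ltry // -EFinB -EFinM ltry.
Qed.

Local Close Scope ereal_scope.

Lemma local_inverse (f h df : R -> R) p q t : derivative f df ->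
  {in `[p, q]%R, cancel f h} -> p < t < q -> df t != 0 ->
  is_derive (f t) 1 h (df t)^-1.
Proof.
move=> Df fK tpq; apply: is_derive_inverse (Df t); last first.
  by apply: filterE => x; exact: (derivative_continuous Df).
have : t \in `]p, q[%R by rewrite in_itv.
move/near_in_itvoo; apply: filterS => x xpq; apply: fK.
exact: subset_itv_oo_cc.
Qed.

Let DX := np_X NP.
Let DY := np_Y NP.

Let ND : derivative (fun t => - X t) (fun t => rho t * sin t).
Proof. by move=> t; derive_tac; rewrite opprK. Qed.

Lemma X_decr t u : 0 <= t -> t < u -> u <= pi -> X u < X t.
Proof.
move=> t0 tu up; rewrite -ltrN2; apply: (derivative_lt ND tu) => v /andP[tv vu].
rewrite mulr_gt0 ?(np_rho_gt0 NP) // sin_gt0_pi // (le_lt_trans t0) //=.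
exact: lt_le_trans vu up.
Qed.

Lemma X_incr t u : pi <= t -> t < u -> u <= 2 * pi -> X t < X u.
Proof.
move=> t0 tu up; apply: (derivative_lt DX tu) => v /andP[tv vu].
rewrite -mulrN -(subrK pi v) sin_addpi opprK mulr_gt0 ?(np_rho_gt0 NP) // sin_gt0_pi //.
by apply/andP; split; lra.
Qed.

(** For a point between the lower and the upper curve point of a vertical line, the upper one
    certifies the half-planes with [sin a > 0] and the lower one those with [sin a < 0]. If
    [sin a = 0], strictness holds because the upper point does not have normal angle [a]. *)
Lemma section_ge x t u : 0 < t < pi -> pi < u < 2 * pi -> X t = x -> X u = x ->
  ((Y t - Y u)%:E <= mu (xsection (body X Y : set plane) x))%E.
Proof.
move=> /andP[t0 tp] /andP[up u2] Xt Xu.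
have sub : `]Y u, Y t[ `<=` xsection (body X Y : set plane) x.
  move=> y; rewrite /= in_itv /= => /andP[uy yt]; rewrite /xsection /= inE => a /=.
  have st := supp_ge NP a t; have su := supp_ge NP a u.
  rewrite Xt Xu /ndot in st su; rewrite /ndot.
  case: (ltgtP (sin a) 0) => sa.
  - by apply: lt_le_trans su; rewrite ltrD2l ltr_nM2l.
  - by apply: lt_le_trans st; rewrite ltrD2l ltr_pM2l.
  - rewrite sa mul0r addr0; rewrite sa mul0r addr0 in st.
    have [[e1 e2]|/eqP ne] := eqVneq (X t, Y t) (X a, Y a).
      have [k aE] := normal_param_inj NP (congr2 pair e1 e2).
      move: sa; rewrite aE (periodic_int sin_add2pi) => s0.
      by have := @sin_gt0_pi _ t; rewrite t0 tp s0 ltxx => /(_ isT).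
    by have := supp_lt_neq NP ne; rewrite /ndot Xt sa mul0r addr0.
have mB : measurable (xsection (body X Y : set plane) x).
  by apply: measurable_xsection; exact: measurable_body.
apply: (@le_trans _ _ (mu `]Y u, Y t[)); last first.
  by apply: le_measure => //; rewrite inE.
rewrite lebesgue_measure_itv /=; case: ifP => h; first by rewrite EFinB.
by rewrite lee_fin subr_le0; move: h; rewrite lte_fin => /negbT; rewrite -leNgt.
Qed.

(** The angles [0] and [pi] mark the rightmost and leftmost points. They cut the curve into an upper
    and a lower arc, on each of which [X] is monotone, and the vertical sections between the arcs
    are integrated. *)
Lemma body_area_ge S : derivative S (fun t => Y t * (rho t * sin t)) ->
  S (2 * pi) - S 0 <= planar_area (body X Y).
Proof.
move=> DS; have p0 := @pi_gt0 R.
have X2 : X (2 * pi) = X 0 by rewrite -[2 * pi]add0r (np_perX NP).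
have Y2 : Y (2 * pi) = Y 0 by rewrite -[2 * pi]add0r (np_perY NP).
(* The vertical line of abscissa [x] meets the curve at the parameters [a x]
   (above) and [c x] (below), and [S (c x) - S (a x)] is an antiderivative of the
   length of the section. *)
pose a x := xget 0 [set t | 0 <= t <= pi /\ X t = x].
pose c x := xget 0 [set t | pi <= t <= 2 * pi /\ X t = x].
have aK : {in `[0, pi]%R, cancel X a}.
  move=> t; rewrite in_itv /= => tI; rewrite /a; case: xgetP => [u _ [uI e]|/(_ t)]; last by case.
  move: tI uI => /andP[t0 tp] /andP[u0 up]; case: (ltgtP u t) => // h.
    by have := X_decr u0 h tp; rewrite e ltxx.
  by have := X_decr t0 h up; rewrite e ltxx.
have cK : {in `[pi, 2 * pi]%R, cancel X c}.
  move=> t; rewrite in_itv /= => tI; rewrite /c; case: xgetP => [u _ [uI e]|/(_ t)]; last by case.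
  move: tI uI => /andP[t0 tp] /andP[u0 up]; case: (ltgtP u t) => // h.
    by have := X_incr u0 h tp; rewrite e ltxx.
  by have := X_incr t0 h up; rewrite e ltxx.
have p12 : pi <= 2 * pi :> R by lra.
have ca : {within `[X pi, X 0], continuous a}.
  by apply: segment_can_ge_continuous aK; [exact: ltW|exact: derivative_within_continuous DX].
have cc : {within `[X pi, X 0], continuous c}.
  by rewrite -X2; apply: segment_can_le_continuous cK; [|exact: derivative_within_continuous DX].
have x01 : X pi < X 0 by exact: X_decr.
have aE x : X pi < x < X 0 -> 0 < a x < pi /\ X (a x) = x.
  move=> /andP[x1 x0].
  have [||t] := @IVT R X 0 pi x (ltW p0).
  - exact: derivative_within_continuous DX.
  - by rewrite ge_min le_max (ltW x1) (ltW x0) orbT.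
  move=> tI e; rewrite -e aK //; split=> //; move: tI; rewrite in_itv /= => /andP[t0 tp].
  rewrite !lt_neqAle t0 tp !andbT; by apply/andP; split; apply/eqP => h; move: e; [rewrite -h|rewrite h]; lra.
have cE x : X pi < x < X 0 -> pi < c x < 2 * pi /\ X (c x) = x.
  move=> /andP[x1 x0].
  have [||t] := @IVT R X pi (2 * pi) x p12.
  - exact: derivative_within_continuous DX.
  - by rewrite X2 ge_min le_max (ltW x1) (ltW x0) orbT.
  move=> tI e; rewrite -e cK //; split=> //; move: tI; rewrite in_itv /= => /andP[t0 tp].
  rewrite !lt_neqAle t0 tp !andbT; by apply/andP; split; apply/eqP => h; move: e; [rewrite -h|rewrite h X2]; lra.
have dX0 t : 0 < sin t \/ sin t < 0 -> - (rho t * sin t) != 0.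
  move=> s0; rewrite oppr_eq0 mulf_neq0 //; first by rewrite lt0r_neq0 // (np_rho_gt0 NP).
  by case: s0 => [/lt0r_neq0|/ltr0_neq0].
pose f x := Y (a x) - Y (c x).
pose F x := S (c x) - S (a x).
have comp (h k : R -> R) : {within `[X pi, X 0], continuous h} -> continuous k ->
    {within `[X pi, X 0], continuous (fun x => k (h x))}.
  by move=> hc kc x; apply: continuous_comp; [exact: hc|exact: kc].
have cY := derivative_continuous DY; have cS := derivative_continuous DS.
have cf : {within `[X pi, X 0], continuous f}.
  by move=> x; apply: cvgB; [exact: (comp a Y)|exact: (comp c Y)].
have cF : {within `[X pi, X 0], continuous F}.
  by move=> x; apply: cvgB; [exact: (comp c S)|exact: (comp a S)].
(* The derivative of [S] is [- Y] times that of [X], so [S] composed with a local inverse of [X] has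
   derivative [- Y]. *)
have dF x : X pi < x < X 0 -> is_derive x 1 F (f x).
  move=> xI; have [aI ea] := aE x xI; have [cI ec] := cE x xI.
  have sa : 0 < sin (a x) by exact: sin_gt0_pi.
  have sc : sin (c x) < 0.
    rewrite -(subrK pi (c x)) sin_addpi oppr_lt0; apply: sin_gt0_pi.
    by move: cI => /andP[? ?]; apply/andP; split; lra.
  have da0 := dX0 _ (or_introl sa); have dc0 := dX0 _ (or_intror sc).
  have da := local_inverse DX aK aI da0; have dc := local_inverse DX cK cI dc0.
  rewrite ea in da; rewrite ec in dc.
  have h := is_derive_add (is_derive_compose (DS (c x)) dc) (is_derive_opp (is_derive_compose (DS (a x)) da)).
  apply: is_derive_congr h _; rewrite /f.
  have r0 t : rho t != 0 by rewrite lt0r_neq0 // (np_rho_gt0 NP).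
  by field; rewrite !r0 (lt0r_neq0 sa) (ltr0_neq0 sc).
have fE : ((\int[mu]_(x in `[X pi, X 0]) (f x)%:E)%E = (S (2 * pi) - S 0)%:E).
  rewrite (@continuous_FTC2 _ f F _ _ x01 cf).
  - rewrite /F -{1}X2.
    have -> : c (X pi) = pi by rewrite cK // in_itv /= lexx p12.
    have -> : a (X pi) = pi by rewrite aK // in_itv /= lexx ltW.
    have -> : c (X (2 * pi)) = 2 * pi by rewrite cK // in_itv /= lexx p12.
    have -> : a (X 0) = 0 by rewrite aK // in_itv /= lexx ltW.
    by rewrite subrr -EFinB subr0.
  - have [_ l r] := (continuous_within_itvP F x01).1 cF.
    split=> // x; rewrite in_itv /= => /dF; by case.
  - by move=> x; rewrite in_itv /= => /dF [_ <-]; rewrite derive1E.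
have f0 x : X pi < x < X 0 -> 0 <= f x.
  move=> xI; have [aI ea] := aE x xI; have [cI ec] := cE x xI.
  have := supp_ge NP (a x) (c x); rewrite /supp /ndot ea ec lerD2l.
  by rewrite ler_pM2l ?sin_gt0_pi // subr_ge0.
rewrite /planar_area -lee_fin fineK; last first.
  by rewrite ge0_fin_numE ?body_area_fin // measure_ge0.
rewrite -fE /product_measure1.
(* At both extreme abscissas the two arcs meet and [section_ge] does not apply, but there the length
   is [0]. *)
have fend : f (X 0) = 0 /\ f (X pi) = 0.
  rewrite /f -{2}X2 (aK 0) ?(cK (2 * pi)) ?(aK pi) ?(cK pi) ?Y2 ?subrr //.
  - by rewrite in_itv /= lexx p12.
  - by rewrite in_itv /= lexx ltW.
  - by rewrite in_itv /= lexx p12.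
  - by rewrite in_itv /= lexx ltW.
have mphi := measurable_fun_xsection mu measurable_body.
have bnd x : x \in `[X pi, X 0]%R ->
    (0 <= (f x)%:E)%E /\ ((f x)%:E <= mu (xsection (body X Y : set plane) x))%E.
  rewrite in_itv /= le_eqVlt => /andP[/orP[/eqP<- _|x1]].
    by rewrite fend.2 lexx; split=> //; exact: measure_ge0.
  rewrite le_eqVlt => /orP[/eqP->|x0].
    by rewrite fend.1 lexx; split=> //; exact: measure_ge0.
  have xI : X pi < x < X 0 by rewrite x1.
  split; first by rewrite lee_fin f0.
  have [aI ea] := aE x xI; have [cI ec] := cE x xI.
  exact: section_ge aI cI ea ec.
apply: (@le_trans _ _ (\int[mu]_(x in `[X pi, X 0]) (mu \o xsection (body X Y : set plane)) x)%E).
  apply: ge0_le_integral => //.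
  - by move=> x /bnd [].
  - apply/measurable_EFinP; apply: subspace_continuous_measurable_fun cf.
    exact: measurable_itv.
  - exact: measurable_funS mphi.
  - by move=> x /bnd [].
exact: ge0_subset_integral.
Qed.

End Area.

(** * The envelope *)

Section PolarAngle.
Context {R : realType}.
Implicit Types (x y t : R).

Lemma same_direction (r s x y : R) : 0 < r -> 0 < s ->
  r * cos x = s * cos y -> r * sin x = s * sin y ->
  exists k : int, x = y + k%:~R * (2 * pi).
Proof.
move=> r0 s0 e1 e2.
have rs : r = s.
  apply/eqP; rewrite -(@eqrXn2 _ 2) ?ltW //; apply/eqP.
  rewrite -[LHS]mulr1 -(cos2Dsin2 x) mulrDr -!exprMn e1 e2 !exprMn -mulrDr.
  by rewrite cos2Dsin2 mulr1.
have r1 := lt0r_neq0 r0; rewrite -rs in e1 e2.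
have := cosB x y; rewrite (mulfI r1 e1) (mulfI r1 e2) -!expr2 cos2Dsin2.
by move/cos2pi_eq1 => [k e]; exists k; rewrite -e addrC subrK.
Qed.

Lemma opposite_direction (r s x y : R) : 0 < r -> 0 < s ->
  r * cos x = - (s * cos y) -> r * sin x = - (s * sin y) ->
  exists k : int, x = y + pi + k%:~R * (2 * pi).
Proof.
move=> r0 s0 e1 e2; apply: (same_direction r0 s0).
  by rewrite e1 cos_addpi mulrN.
by rewrite e2 sin_addpi mulrN.
Qed.

Lemma small_turn (k : int) : - (2 * (pi : R)) < k%:~R * (2 * (pi : R)) < 2 * (pi : R) -> k = 0.
Proof.
have p0 := @twopi_gt0 R.
move=> /andP[h1 h2].
have : (-1)%:~R < k%:~R :> R by rewrite -(ltr_pM2r p0) mulrN1z mulN1r.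
have : k%:~R < 1%:~R :> R by rewrite -(ltr_pM2r p0) mul1r.
by rewrite !ltr_int; lia.
Qed.

(** In the frame at [t] the vector lies in an open half-plane, so [t] plus an arctangent is a smooth
    angle. Its distance below [pi / 2] from [t] later determines the integers left open by equality
    of directions. *)
Lemma polar_angle (z1 z2 dz1 dz2 : R -> R) :
  cinf z1 -> cinf z2 -> derivative z1 dz1 -> derivative z2 dz2 ->
  (forall t, 0 < ndot t (z1 t) (z2 t)) ->
  exists phi, [/\ cinf phi,
    derivative phi (fun t => (z1 t * dz2 t - z2 t * dz1 t) / (z1 t ^+ 2 + z2 t ^+ 2)),
    forall t, t - pi / 2 < phi t < t + pi / 2 &
    forall t, exists2 r, 0 < r & z1 t = r * cos (phi t) /\ z2 t = r * sin (phi t)].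
Proof.
move=> C1 C2 D1 D2 N0.
pose N t := ndot t (z1 t) (z2 t); pose T t := tdot t (z1 t) (z2 t).
have Nn0 t : N t != 0 by rewrite lt0r_neq0 // N0.
have NT t : N t ^+ 2 + T t ^+ 2 = z1 t ^+ 2 + z2 t ^+ 2.
  by rewrite -[RHS]mul1r -(cos2Dsin2 t) /N /T /ndot /tdot; ring.
have q0 t : z1 t ^+ 2 + z2 t ^+ 2 != 0.
  by rewrite -NT lt0r_neq0 // ltr_pwDl ?sqr_ge0 // exprn_gt0 // N0.
have CN : cinf N by rewrite /N /ndot; cinf_tac.
have CT : cinf T by rewrite /T /tdot; cinf_tac.
have DN : derivative N (fun t => T t + ndot t (dz1 t) (dz2 t)).
  by move=> t; rewrite /N /T /ndot /tdot; derive_tac; ring.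
have DT : derivative T (fun t => - N t + tdot t (dz1 t) (dz2 t)).
  by move=> t; rewrite /N /T /ndot /tdot; derive_tac; ring.
have CV : cinf (fun t => (N t)^-1) by exact: cinfV.
exists (fun t => t + atan (T t * (N t)^-1)); split.
- by cinf_tac.
- move=> t; have h := is_derive_add (is_derive_self t) (is_derive_atan_comp (is_derive_mul (DT t) (is_derive_inv (Nn0 t) (DN t)))).
  apply: is_derive_congr h _.
  have e : z1 t * dz2 t - z2 t * dz1 t =
    N t * tdot t (dz1 t) (dz2 t) - T t * ndot t (dz1 t) (dz2 t).
    by rewrite -[LHS]mul1r -(cos2Dsin2 t) /N /T /ndot /tdot; ring.
  have := q0 t; rewrite e -NT; move: (Nn0 t) => /=.
  move: (N t) (T t) (ndot t _ _) (tdot t _ _) => n m a b n0 nm0.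
  by field; rewrite n0 nm0.
- by move=> t; have := atan_gtNpi2 (T t / N t); have := atan_ltpi2 (T t / N t) => ? ?; apply/andP; split; lra.
- move=> t; set th := atan _.
  have c0 : 0 < cos th by apply: cos_gt0_pihalf; rewrite atan_gtNpi2 atan_ltpi2.
  have sE : sin th = T t / N t * cos th.
    have := atanK (T t / N t); rewrite -/th /tan => <-.
    by rewrite divfK // lt0r_neq0.
  exists (N t / cos th); first by rewrite divr_gt0 // N0.
  have rE x : N t / cos th * x = N t * (x / cos th) by ring.
  have sc : sin th / cos th = T t / N t by rewrite sE mulfK // lt0r_neq0.
  split; rewrite ?cosD ?sinD rE.
    rewrite (_ : (_ - _) / _ = cos t - sin t * (sin th / cos th)); last by field; rewrite lt0r_neq0.
    rewrite sc mulrBr (_ : N t * (sin t * _) = T t * sin t); last by field.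
    by rewrite -[LHS]mul1r -(cos2Dsin2 t) /N /T /ndot /tdot; ring.
  rewrite (_ : (_ + _) / _ = sin t + cos t * (sin th / cos th)); last by field; rewrite lt0r_neq0.
  rewrite sc mulrDr (_ : N t * (cos t * _) = T t * cos t); last by field.
  by rewrite -[LHS]mul1r -(cos2Dsin2 t) /N /T /ndot /tdot; ring.
Qed.

End PolarAngle.

(** * Chords through an interior point and their images *)

Section Chords.
Context {R : realType}.
Context (g : R -> R * R) (X Y rho : R -> R) (NP : normal_param g X Y rho).
Implicit Types (a b t : R) (p z : R * R).

Let DX := np_X NP.
Let DY := np_Y NP.
Let cX := np_cX NP.
Let cY := np_cY NP.
Let crho := np_crho NP.
Let rho_gt0 := np_rho_gt0 NP.

(** Parallel tangents have normal angles that differ by a multiple of [pi]; the even multiples lead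
    back to the same point. *)
Lemma iota_ovalE a : iota_oval g (X a, Y a) = (X (a + pi), Y (a + pi)).
Proof.
have p0 := @pi_gt0 R.
have ne : (X (a + pi), Y (a + pi)) <> (X a, Y a).
  move=> [e1 e2]; have := @supp_lt _ _ _ _ _ NP a (a + pi).
  by rewrite e1 e2 ltxx => h; apply: notF; apply: h; apply/andP; split; lra.
apply: xget_unique => [|y [ney /(np_tangents NP) [a' [b' [e ye s0]]]]].
  split=> //; apply/(np_tangents NP); exists a, (a + pi); split=> //.
  by rewrite addrAC subrr add0r sinpi.
have [k a'E] := normal_param_inj NP e.
have [j [bE|bE]] := sin_eq0 s0.
  case: ney; rewrite ye (_ : b' = a' + j%:~R * (2 * pi)); last by rewrite -bE addrC subrK.
  by rewrite (periodicX NP) (periodicY NP) -e.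
rewrite ye (_ : b' = a + pi + k%:~R * (2 * pi) + j%:~R * (2 * pi)).
  by rewrite !(periodicX NP) !(periodicY NP).
by rewrite -[b'](subrK a') bE a'E; ring.
Qed.

Context (p1 p2 : R) (pin : body X Y (p1, p2)).

(* [b a] is the normal angle of the second endpoint of the chord through [p]
   whose first endpoint is [G a = (X a, Y a)]. *)
Lemma opposite_end : exists b db : R -> R,
  [/\ cinf b, derivative b db & forall a, 0 < db a] /\
  [/\ forall a, a < b a < a + 2 * pi, forall a, b (b a) = a + 2 * pi,
      forall a, (X (b a) - X a) * (p2 - Y a) - (Y (b a) - Y a) * (p1 - X a) = 0 &
      forall a c, (X c - X a) * (p2 - Y a) - (Y c - Y a) * (p1 - X a) = 0 ->
        (X c, Y c) = (X a, Y a) \/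
        exists k : int, c = b a + k%:~R * (2 * pi)].
Proof.
have pi0 := @pi_gt0 R; have pi20 := @twopi_gt0 R.
pose z1 a := X a - p1; pose z2 a := Y a - p2.
have c1 : cinf z1 by rewrite /z1; cinf_tac.
have c2 : cinf z2 by rewrite /z2; cinf_tac.
have d1 : derivative z1 (fun t => - (rho t * sin t)).
  by move=> t; rewrite /z1; derive_tac; rewrite oppr0 addr0.
have d2 : derivative z2 (fun t => rho t * cos t).
  by move=> t; rewrite /z2; derive_tac; rewrite oppr0 addr0.
have N0 t : 0 < ndot t (z1 t) (z2 t).
  by have := pin t; rewrite /= /supp /ndot /z1 /z2; lra.
have [phi [cphi Dphi phi_near phi_dir]] := polar_angle c1 c2 d1 d2 N0.
set dphi := fun t => _ in Dphi.
have dphi0 t : 0 < dphi t.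
  rewrite /dphi (_ : _ - _ = rho t * ndot t (z1 t) (z2 t)); last by rewrite /ndot; ring.
  rewrite divr_gt0 ?mulr_gt0 //; have [r r0 [-> ->]] := phi_dir t.
  by rewrite !exprMn -mulrDr cos2Dsin2 mulr1 exprn_gt0.
have phi2 t : phi (t + 2 * pi) = phi t + 2 * pi.
  have [r r0 [e1 e2]] := phi_dir t; have [s s0 [f1 f2]] := phi_dir (t + 2 * pi).
  have e1' : s * cos (phi (t + 2 * pi)) = r * cos (phi t).
    by rewrite -f1 -e1 /z1 (np_perX NP).
  have e2' : s * sin (phi (t + 2 * pi)) = r * sin (phi t).
    by rewrite -f2 -e2 /z2 (np_perY NP).
  have [k kE] := same_direction s0 r0 e1' e2'.
  have k1 : k - 1 = 0.
    apply: (@small_turn R); rewrite intrB mulrBl mul1r.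
    have := phi_near t; have := phi_near (t + 2 * pi); rewrite kE.
    by set K := k%:~R * _; lra.
  by rewrite kE; have -> : k = 1; [lia|rewrite mul1r].
have surj := quasi_periodic_surj pi20 (cinf_continuous cphi) phi2.
have [psi [phiK psiK] Dpsi] := derivative_inverse Dphi dphi0 surj.
have dphin t : dphi t != 0 by rewrite lt0r_neq0.
have cpsi : cinf psi := cinf_inverse cphi Dphi dphin Dpsi.
have phi_mono := derivative_incr Dphi dphi0.
(* Seen from [p], the point with normal angle [a] lies in direction [phi a], and the other end of
   the chord in the opposite direction. *)
pose b a := psi (phi a + pi).
have phib a : phi (b a) = phi a + pi by rewrite /b psiK.
have bb a : b (b a) = a + 2 * pi.
  by apply: (can_inj phiK); rewrite !phib phi2; ring.
have dir_b a c : phi c = phi a + pi -> exists2 r, 0 < r &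
    z1 c = - (r * z1 a) /\ z2 c = - (r * z2 a).
  move=> e; have [r r0 [e1 e2]] := phi_dir a; have [s s0 [f1 f2]] := phi_dir c.
  exists (s / r); first by rewrite divr_gt0.
  by rewrite f1 f2 e e1 e2 cos_addpi sin_addpi; split; field; rewrite lt0r_neq0.
exists b, (fun a => (dphi (psi (phi a + pi)))^-1 * dphi a); split; split.
- by rewrite /b; cinf_tac.
- by move=> a; rewrite /b; derive_tac; rewrite addr0.
- by move=> a; rewrite mulr_gt0 // invr_gt0.
- by move=> a; apply/andP; split; rewrite -(leW_mono phi_mono) phib ?phi2; lra.
- exact: bb.
- move=> a; have [r r0 []] := dir_b a (b a) (phib a); rewrite /z1 /z2 => e1 e2.
  have -> : X (b a) = p1 - r * (X a - p1) by move: e1; lra.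
  have -> : Y (b a) = p2 - r * (Y a - p2) by move: e2; lra.
  ring.
- move=> a c e; have [r r0 [e1 e2]] := phi_dir a; have [s s0 [f1 f2]] := phi_dir c.
  have sin0 : sin (phi c - phi a) = 0.
    have : r * s * sin (phi c - phi a) = 0.
      rewrite sinB; transitivity (z1 a * z2 c - z2 a * z1 c).
        by rewrite e1 e2 f1 f2; ring.
      by rewrite /z1 /z2 -[RHS]e; ring.
    by move/eqP; rewrite !mulf_eq0 (gt_eqF r0) (gt_eqF s0) => /eqP.
  have phik := quasi_periodic_int phi2.
  have [k [kE|kE]] := sin_eq0 sin0; [left|right].
    have -> : c = a + k%:~R * (2 * pi).
      by apply: (can_inj phiK); rewrite phik -kE; ring.
    by rewrite (periodicX NP) (periodicY NP).
  exists k; apply: (can_inj phiK); rewrite phik phib.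
  by rewrite -[phi c](subrK (phi a)) kE; ring.
Qed.

Lemma line_throughE (x1 x2 y1 y2 : R) z : line_through (x1, x2) (y1, y2) z <->
  (y1 - x1) * (z.2 - x2) - (y2 - x2) * (z.1 - x1) = 0.
Proof. by []. Qed.

Lemma disc_convex (r l x y x' y' : R) : 0 <= l -> l <= 1 ->
  x ^+ 2 + y ^+ 2 <= r -> x' ^+ 2 + y' ^+ 2 <= r ->
  (x + l * (x' - x)) ^+ 2 + (y + l * (y' - y)) ^+ 2 <= r.
Proof.
move=> l0 l1 h h'.
have e : (x + l * (x' - x)) ^+ 2 + (y + l * (y' - y)) ^+ 2 =
    (1 - l) * (x ^+ 2 + y ^+ 2) + l * (x' ^+ 2 + y' ^+ 2)
    - l * (1 - l) * ((x - x') ^+ 2 + (y - y') ^+ 2) by ring.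
have a1 : (1 - l) * (x ^+ 2 + y ^+ 2) <= (1 - l) * r by rewrite ler_wpM2l ?subr_ge0.
have a2 : l * (x' ^+ 2 + y' ^+ 2) <= l * r by rewrite ler_wpM2l.
have a3 : 0 <= l * (1 - l) * ((x - x') ^+ 2 + (y - y') ^+ 2).
  by rewrite !mulr_ge0 ?subr_ge0 // addr_ge0 // sqr_ge0.
by rewrite e; lra.
Qed.

(** The image chord runs along [(z1 a, z2 a)], whose direction [om a] increases bijectively;
    inverting it yields the chord for each normal angle. The disc bound holds because the front
    point is a convex combination of two curve points. *)
Lemma ART_offset_spec : exists q dq ddq : R -> R,
  [/\ cinf q, derivative q dq, derivative dq ddq & cinf ddq] /\
  [/\ ART_offset g (p1, p2) = q, forall t, q (t + pi) = - q t &
    forall o1 o2 r, (forall t, (X t - o1) ^+ 2 + (Y t - o2) ^+ 2 <= r) ->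
      forall t, (p1 + (q t * cos t - dq t * sin t) - o1) ^+ 2 +
                (p2 + (q t * sin t + dq t * cos t) - o2) ^+ 2 <= r].
Proof.
have pi0 := @pi_gt0 R; have pi20 := @twopi_gt0 R.
have [b [db [[cb Db db0] [b_near bb chord_p chord_uniq]]]] := opposite_end.
pose z1 a := X (b a + pi) - X (a + pi); pose z2 a := Y (b a + pi) - Y (a + pi).
(* [cA] and [cB] are the contributions of the two endpoints to the rotation of
   the image chord; the point of contact with the envelope divides this chord in
   the ratio [cA : cB]. *)
pose cA a := rho (a + pi) * (- ndot (a + pi) (z1 a) (z2 a)).
pose cB a := db a * rho (b a + pi) * ndot (b a + pi) (z1 a) (z2 a).
pose dz1 a := - (rho (b a + pi) * sin (b a + pi)) * db a + rho (a + pi) * sin (a + pi).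
pose dz2 a := rho (b a + pi) * cos (b a + pi) * db a - rho (a + pi) * cos (a + pi).
have cz1 : cinf z1 by rewrite /z1; cinf_tac.
have cz2 : cinf z2 by rewrite /z2; cinf_tac.
have Dz1 : derivative z1 dz1 by move=> a; rewrite /z1 /dz1; derive_tac; ring.
have Dz2 : derivative z2 dz2 by move=> a; rewrite /z2 /dz2; derive_tac; ring.
have crossE a : z1 a * dz2 a - z2 a * dz1 a = cA a + cB a.
  by rewrite /dz1 /dz2 /cA /cB /ndot; ring.
have Agt a : ndot (a + pi) (z1 a) (z2 a) < 0.
  have := @supp_lt _ _ _ _ _ NP (a + pi) (b a + pi).
  have /andP[h1 h2] := b_near a; have -> : a + pi < b a + pi < a + pi + 2 * pi.
    by apply/andP; split; lra.
  by move/(_ isT); rewrite /supp /ndot /z1 /z2; lra.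
have Bgt a : 0 < ndot (b a + pi) (z1 a) (z2 a).
  have := @supp_lt _ _ _ _ _ NP (b a + pi) (a + pi + 2 * pi).
  have /andP[h1 h2] := b_near a.
  have -> : b a + pi < a + pi + 2 * pi < b a + pi + 2 * pi by apply/andP; split; lra.
  by move/(_ isT); rewrite (np_perX NP) (np_perY NP) /supp /ndot /z1 /z2; lra.
have cA0 a : 0 < cA a by rewrite /cA mulr_gt0 // oppr_gt0.
have cB0 a : 0 < cB a by rewrite /cB !mulr_gt0.
have N0 a : 0 < ndot a (z1 a) (z2 a) by have := Agt a; rewrite ndot_addpi; lra.
have [om [com Dom om_near om_dir]] := polar_angle cz1 cz2 Dz1 Dz2 N0.
set dom := fun t => _ in Dom.
have domE a r : z1 a = r * cos (om a) -> z2 a = r * sin (om a) ->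
    dom a = (cA a + cB a) / r ^+ 2.
  move=> e1 e2; rewrite /dom crossE e1 e2 !exprMn -mulrDr cos2Dsin2 mulr1 //.
have dom0 a : 0 < dom a.
  have [r r0 [e1 e2]] := om_dir a.
  by rewrite (domE a r e1 e2) divr_gt0 ?exprn_gt0 // addr_gt0.
have zb a : z1 (b a) = - z1 a /\ z2 (b a) = - z2 a.
  rewrite /z1 /z2 bb (_ : a + 2 * pi + pi = a + pi + 2 * pi) ?(np_perX NP) ?(np_perY NP).
    by split; ring.
  by ring.
(* Starting from the other end describes the same chord backwards; this is the source of the
   antiperiodicity of [q]. *)
have omb a : om (b a) = om a + pi.
  have [r r0 [e1 e2]] := om_dir a; have [s s0 [f1 f2]] := om_dir (b a).
  have [w1 w2] := zb a.
  have [k kE] : exists k : int, om (b a) = om a + pi + k%:~R * (2 * pi).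
    by apply: (opposite_direction s0 r0); rewrite -?f1 -?f2 -?e1 -?e2.
  have k0 : k = 0.
    apply: (@small_turn R); have := om_near a; have := om_near (b a); have := b_near a.
    by rewrite kE; set K := k%:~R * _ => /andP[? ?] /andP[? ?] /andP[? ?]; apply/andP; split; lra.
  by rewrite kE k0 mul0r addr0.
have om2 a : om (a + 2 * pi) = om a + 2 * pi by rewrite -bb !omb; ring.
have [kap [omK kapK] Dkap] := derivative_inverse Dom dom0
  (quasi_periodic_surj pi20 (cinf_continuous com) om2).
have domn a : dom a != 0 by rewrite lt0r_neq0.
have ckap : cinf kap := cinf_inverse com Dom domn Dkap.
have kap_pi y : kap (y + pi) = b (kap y) by apply: (can_inj omK); rewrite kapK omb kapK.
have kap_int (k : int) y : kap (y + k%:~R * (2 * pi)) = kap y + k%:~R * (2 * pi).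
  by apply: (can_inj omK); rewrite (quasi_periodic_int om2) !kapK.
(* A line with direction [om] has normal angle [om + pi / 2], so [A t] is the starting angle whose
   image chord has normal [normal t]. *)
pose A t := kap (t - pi / 2).
have cA' : cinf A by rewrite /A; cinf_tac.
have DA : derivative A (fun t => (dom (A t))^-1).
  by move=> t; rewrite /A; derive_tac; ring.
have dirA t : exists2 r, 0 < r & z1 (A t) = r * sin t /\ z2 (A t) = - (r * cos t) /\
    dom (A t) = (cA (A t) + cB (A t)) / r ^+ 2.
  have [r r0 [e1 e2]] := om_dir (A t); exists r => //.
  split; [|split; last exact: domE].
    by rewrite e1 /A kapK cosBpihalf.
  by rewrite e2 /A kapK sinBpihalf mulrN.
pose q t := ndot t (X (A t + pi) - p1) (Y (A t + pi) - p2).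
have qv t : q t = ndot t (X (b (A t) + pi) - p1) (Y (b (A t) + pi) - p2).
  have [r _ [e1 [e2 _]]] := dirA t; apply/eqP; rewrite -subr_eq0; apply/eqP.
  transitivity (- ndot t (z1 (A t)) (z2 (A t))); first by rewrite /q /z1 /z2 /ndot; ring.
  by rewrite e1 e2 /ndot; ring.
have cq : cinf q by rewrite /q /ndot; cinf_tac.
have [dq Dq cdq] := cinf_derivableE cq; have [ddq Ddq cddq] := cinf_derivableE cdq.
exists q, dq, ddq; split=> //; split.
- apply/funext => t; have [r rp [e1 [e2 _]]] := dirA t.
  rewrite /ART_offset; apply: xget_unique => [|q' [_ [_ [/(np_range NP) [a ->] /(np_range NP) [c ->] ne onp]]]].
    exists (X (A t), Y (A t)), (X (b (A t)), Y (b (A t))); split.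
    - by apply/(np_range NP); exists (A t).
    - by apply/(np_range NP); exists (b (A t)).
    - move=> [f1 f2]; have := supp_lt NP (b_near (A t)).
      by rewrite -f1 -f2 ltxx.
    - by apply/line_throughE; exact: chord_p.
    rewrite !iota_ovalE; apply/seteqP; split=> z.
      move=> h; apply/line_throughE; rewrite -/(z1 (A t)) -/(z2 (A t)) e1 e2.
      have {}h : cos t * (z.1 - p1) + sin t * (z.2 - p2) = q t := h.
      transitivity (r * (cos t * (z.1 - p1) + sin t * (z.2 - p2) - q t)).
        by rewrite /q /ndot; ring.
      by rewrite h subrr mulr0.
    move/line_throughE; rewrite -/(z1 (A t)) -/(z2 (A t)) e1 e2 => h.
    have : r * (cos t * (z.1 - p1) + sin t * (z.2 - p2) - q t) = 0.
      by rewrite -h /q /ndot; ring.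
    by move/eqP; rewrite mulf_eq0 (gt_eqF rp) subr_eq0 => /eqP.
  move/line_throughE: onp => /= onp.
  have [e|[k cE]] := chord_uniq a c onp; first by case: ne.
  rewrite cE (periodicX NP) (periodicY NP) !iota_ovalE => LE.
  have inL z : cos t * (z.1 - p1) + sin t * (z.2 - p2) = q' <->
      line_through (X (a + pi), Y (a + pi)) (X (b a + pi), Y (b a + pi)) z.
    by rewrite -LE.
  have qu : ndot t (X (a + pi) - p1) (Y (a + pi) - p2) = q'.
    by apply/(inL (X (a + pi), Y (a + pi))); apply/line_throughE; rewrite /=; ring.
  have qv' : ndot t (X (b a + pi) - p1) (Y (b a + pi) - p2) = q'.
    by apply/(inL (X (b a + pi), Y (b a + pi))); apply/line_throughE; rewrite /=; ring.
  have s0 : sin (t - pi / 2 - om a) = 0.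
    have [s sp [f1 f2]] := om_dir a.
    have : ndot t (z1 a) (z2 a) = 0.
      by rewrite -(subrr q') -{1}qv' -qu /ndot /z1 /z2; ring.
    rewrite f1 f2 sinB sinBpihalf cosBpihalf /ndot => h.
    have : s * (- cos t * cos (om a) - sin t * sin (om a)) = 0 by rewrite -oppr0 -h; ring.
    by move/eqP; rewrite mulf_eq0 (gt_eqF sp) => /eqP.
  (* A given chord may be described from either of its ends, so [A t] is [a] or [b a] up to full
     turns; both give the same offset. *)
  have [j [jE|jE]] := sin_eq0 s0.
    have -> : q t = ndot t (X (a + pi) - p1) (Y (a + pi) - p2).
      rewrite /q (_ : A t = a + j%:~R * (2 * pi)); last first.
        by apply: (can_inj omK); rewrite /A kapK (quasi_periodic_int om2) -jE; ring.
      by rewrite addrAC (periodicX NP) (periodicY NP).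
    by rewrite qu.
  have -> : q t = ndot t (X (b a + pi) - p1) (Y (b a + pi) - p2).
    rewrite /q (_ : A t = b a + j%:~R * (2 * pi)); last first.
      apply: (can_inj omK); rewrite /A kapK (quasi_periodic_int om2) omb.
      by rewrite -[LHS](subrK (om a)) jE; ring.
    by rewrite addrAC (periodicX NP) (periodicY NP).
  by rewrite qv'.
- move=> t; rewrite [in RHS]qv {1}/q (_ : A (t + pi) = b (A t)); last first.
    by rewrite /A addrAC kap_pi.
  by rewrite ndot_addpi.
- move=> o1 o2 r0 disc t; have [r rp [e1 [e2 e3]]] := dirA t.
  set a := A t in e1 e2 e3.
  (* The tangential coordinate of the front point: start at the end with angle [a + pi] and move
     along the chord, of length [r], by the fraction [cA a / (cA a + cB a)]. *)
  have dqE : dq t = tdot t (X (a + pi) - p1) (Y (a + pi) - p2) - cA a * r / (cA a + cB a).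
    have D : is_derive t 1 q (tdot t (X (a + pi) - p1) (Y (a + pi) - p2) +
        ndot t (- (rho (a + pi) * sin (a + pi))) (rho (a + pi) * cos (a + pi)) / dom a).
      by rewrite /q /ndot /tdot; derive_tac; rewrite /= -/a; ring.
    rewrite (is_derive_unique (Dq t) D); congr (_ + _).
    have h : cA a = - (r * ndot t (- (rho (a + pi) * sin (a + pi))) (rho (a + pi) * cos (a + pi))).
      by rewrite /cA e1 e2 /ndot; ring.
    have -> : ndot t (- (rho (a + pi) * sin (a + pi))) (rho (a + pi) * cos (a + pi)) = - (cA a / r).
      by rewrite h; field; rewrite lt0r_neq0.
    by rewrite e3; field; rewrite !lt0r_neq0 // addr_gt0.
  have c0 : 0 < cA a + cB a by rewrite addr_gt0.
  pose l := cA a / (cA a + cB a).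
  have l0 : 0 <= l by rewrite divr_ge0 ?ltW.
  have l1 : l <= 1 by rewrite ler_pdivrMr // mul1r lerDl ltW.
  have := disc_convex l0 l1 (disc (a + pi)) (disc (b a + pi)).
  have -> : X (b a + pi) - o1 - (X (a + pi) - o1) = z1 a by rewrite /z1; ring.
  have -> : Y (b a + pi) - o2 - (Y (a + pi) - o2) = z2 a by rewrite /z2; ring.
  have qE : q t = ndot t (X (a + pi) - p1) (Y (a + pi) - p2) by [].
  have cs := cos2Dsin2 t.
  set w1 := X (a + pi) - o1 + _; set w2 := Y (a + pi) - o2 + _.
  have -> : p1 + (q t * cos t - dq t * sin t) - o1 = w1.
    rewrite qE dqE /w1 e1 /l /ndot /tdot.
    transitivity ((cos t ^+ 2 + sin t ^+ 2) * (X (a + pi) - p1) + p1 - o1 + cA a * r / (cA a + cB a) * sin t); first ring.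
    by rewrite cs; ring.
  have -> : p2 + (q t * sin t + dq t * cos t) - o2 = w2.
    rewrite qE dqE /w2 e2 /l /ndot /tdot.
    transitivity ((cos t ^+ 2 + sin t ^+ 2) * (Y (a + pi) - p2) + p2 - o2 - cA a * r / (cA a + cB a) * cos t); first ring.
    by rewrite cs; ring.
  by [].
Qed.

End Chords.

(** * The energy bound *)

Section Energy.
Context {R : realType}.
Context (g : R -> R * R) (X Y rho : R -> R) (NP : normal_param g X Y rho).

Lemma Rintegral_FTC (f F : R -> R) (a b : R) : a < b -> continuous f ->
  derivative F f ->
  (\int[@lebesgue_measure R]_(t in `[a, b]) f t)%R = F b - F a.
Proof.
move=> ab fc DF; rewrite /Rintegral (@continuous_FTC2 _ f F _ _ ab) //.
- exact: continuous_subspaceT.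
- have [_ l r] := (continuous_within_itvP F ab).1 (derivative_within_continuous DF).
  by split=> // x _; case: (DF x).
- by move=> x _; rewrite (derivative1E DF).
Qed.

(* The oriented area does not depend on the origin, which is moved to the
   centre [(o1, o2)] of a disc containing the front. *)
Lemma ART_energy_le (o1 o2 r : R) (p : R * R) :
  (forall t, (X t - o1) ^+ 2 + (Y t - o2) ^+ 2 <= r) ->
  ART_energy g p <= r * pi / 2.
Proof.
move=> disc; have pi0 := @pi_gt0 R.
have r0 : 0 <= r by apply: le_trans (disc 0); rewrite addr_ge0 // sqr_ge0.
rewrite /ART_energy; case: asboolP => [|_]; last by rewrite divr_ge0 // mulr_ge0 // ltW.
rewrite (inside_body NP); case: p => p1 p2 pin.
have [q [dq [ddq [[cq Dq Ddq cddq] [qE q_pi bnd]]]]] := ART_offset_spec NP pin.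
have cdq : cinf dq := cinf_derivative Ddq cddq.
have frontE : ART_front g (p1, p2) = fun t =>
    (p1 + q t * cos t + dq t * - sin t, p2 + q t * sin t + dq t * cos t).
  by apply/funext => t; rewrite /ART_front qE (derivative1E Dq).
rewrite /ART_area /oriented_area frontE.
have D1 : derivative (fun t => p1 + q t * cos t + dq t * - sin t)
    (fun t => - ((q t + ddq t) * sin t)) by move=> t; derive_tac; rewrite /=; ring.
have D2 : derivative (fun t => p2 + q t * sin t + dq t * cos t)
    (fun t => (q t + ddq t) * cos t) by move=> t; derive_tac; rewrite /=; ring.
rewrite (derive1_pair D1 D2).
pose f t := (q t + ddq t) * (ndot t p1 p2 + q t).
have -> : (fun t => cross (p1 + q t * cos t + dq t * - sin t, p2 + q t * sin t + dq t * cos t)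
    (- ((q t + ddq t) * sin t), (q t + ddq t) * cos t)) = f.
  apply/funext => t; rewrite /cross /f /ndot /=.
  transitivity ((q t + ddq t) * (cos t * p1 + sin t * p2 + q t * (cos t ^+ 2 + sin t ^+ 2))).
    by ring.
  by rewrite cos2Dsin2 mulr1.
have cf : continuous f by apply: cinf_continuous; rewrite /f /ndot; cinf_tac.
have [J DJ] := antiderivative cf.
rewrite (Rintegral_FTC pi0 cf DJ).
pose Q t := q t + ndot t (p1 - o1) (p2 - o2).
pose dQ t := dq t + tdot t (p1 - o1) (p2 - o2).
(* [Q] is the support function of the front about [(o1, o2)], and [W] collects the boundary terms of
   the partial integration and of the change of origin. Every factor changes sign under the shift by
   [pi], so [W] takes the same value at [0] and [pi]. *)
pose W t := Q t * dQ t + ndot t o1 o2 * dQ t - tdot t o1 o2 * Q t.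
have DW : derivative W (fun t => f t + dQ t ^+ 2 - Q t ^+ 2).
  by move=> t; rewrite /W /Q /dQ /f /ndot /tdot; derive_tac; rewrite /=; ring.
have dq_pi t : dq (t + pi) = - dq t.
  have h := derivative_shift pi Dq.
  have E : (fun t => q (t + pi)) = fun t => - q t by apply/funext.
  rewrite E in h; have h' : derivative (fun t => - q t) (fun t => - dq t) by move=> u; derive_tac.
  exact: is_derive_unique (h t) (h' t).
have W_pi : W pi = W 0.
  have Qp : Q pi = - Q 0 by rewrite /Q -[pi]add0r q_pi ndot_addpi; ring.
  have dQp : dQ pi = - dQ 0 by rewrite /dQ -[pi]add0r dq_pi tdot_addpi; ring.
  by rewrite /W Qp dQp -[pi]add0r ndot_addpi tdot_addpi; ring.
have bQ t : Q t ^+ 2 + dQ t ^+ 2 <= r.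
  apply: le_trans (bnd _ _ _ disc t); rewrite le_eqVlt; apply/orP; left; apply/eqP.
  rewrite /Q /dQ /ndot /tdot; set u := p1 - o1; set v := p2 - o2.
  have -> : p1 + (q t * cos t - dq t * sin t) - o1 = u + (q t * cos t - dq t * sin t).
    by rewrite /u; ring.
  have -> : p2 + (q t * sin t + dq t * cos t) - o2 = v + (q t * sin t + dq t * cos t).
    by rewrite /v; ring.
  transitivity ((u ^+ 2 + v ^+ 2 + q t ^+ 2 + dq t ^+ 2) * (cos t ^+ 2 + sin t ^+ 2) +
    2 * (q t * (cos t * u + sin t * v) + dq t * (cos t * v - sin t * u)) +
    (q t ^+ 2 + dq t ^+ 2) * (1 - (cos t ^+ 2 + sin t ^+ 2))); first by ring.
  have e := cos2Dsin2 t.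
  transitivity ((u ^+ 2 + v ^+ 2) + (q t ^+ 2 + dq t ^+ 2) * (cos t ^+ 2 + sin t ^+ 2) +
    2 * (q t * (cos t * u + sin t * v) + dq t * (cos t * v - sin t * u))).
    by rewrite e; ring.
  by ring.
have DK : derivative (fun t => J t - W t + r * t) (fun t => f t - (f t + dQ t ^+ 2 - Q t ^+ 2) + r).
  by move=> t; derive_tac; rewrite /=; ring.
have := derivative_le DK (ltW pi0); rewrite W_pi mulr0 addr0 => h.
have {h} : J 0 - W 0 <= J pi - W 0 + r * pi.
  apply: h => t _; have := bQ t; have := sqr_ge0 (Q t); lra.
lra.
Qed.

End Energy.

Unset Implicit Arguments.

Theorem corollary7p3 (R : realType) (gamma : R -> R * R) (w : R)
    (hC : oval gamma) (hw : constant_width gamma w) :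
  (delta_ART gamma < (pi / (3 * (pi - Num.sqrt 3)))%:E)%E.
Proof.
have [X [Y [rho NP]]] := oval_normal_param hC.
have w0 := width_gt0 NP hw.
have [c1 [c2 [t0 hexE]]] := hexagon_center NP hw.
have [r rw disc] := circumradius NP hw hexE.
have [S DS] : exists S, derivative S (fun t => Y t * (rho t * sin t)).
  apply: antiderivative; apply: cinf_continuous.
  by have cY := np_cY NP; have crho := np_crho NP; cinf_tac.
have pi0 := @pi_gt0 R.
have pi3 : 0 < pi - Num.sqrt 3 :> R.
  rewrite subr_gt0; apply: lt_le_trans (pi_ge2 R).
  by rewrite -(@ltr_pXn2r _ 2) ?nnegrE ?sqrtr_ge0 // sqr_sqrtr //; lra.
have area : (pi - Num.sqrt 3) / 2 * w ^+ 2 <= enclosed_area gamma.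
  rewrite /enclosed_area (inside_body NP).
  exact: le_trans (blaschke_lebesgue NP hw hexE DS) (body_area_ge NP DS).
set A := enclosed_area gamma in area.
have low : 0 < (pi - Num.sqrt 3) / 2 * w ^+ 2 by rewrite mulr_gt0 ?exprn_gt0 ?divr_gt0.
have A0 : 0 < A := lt_le_trans low area.
have r0 : 0 <= r by apply: le_trans (disc 0); rewrite addr_ge0 // sqr_ge0.
(* The supremum is first bounded weakly through [r]; strictness enters only afterwards, from
   [r < w ^+ 2 / 3]. *)
apply: (@le_lt_trans _ _ (r * pi / 2 / A)%:E).
  apply: ge_ereal_sup => _ [p _ <-]; rewrite lee_fin ler_pM2r ?invr_gt0 //.
  exact: (ART_energy_le NP p disc).
rewrite lte_fin ltr_pdivrMr //; apply: (@lt_le_trans _ _ (w ^+ 2 / 3 * pi / 2)).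
  by rewrite !ltr_pM2r ?invr_gt0.
have -> : w ^+ 2 / 3 * pi / 2 = pi / (3 * (pi - Num.sqrt 3)) * ((pi - Num.sqrt 3) / 2 * w ^+ 2).
  move: (lt0r_neq0 pi3); set d := pi - Num.sqrt 3; move: d; generalize (pi : R) => p d d0.
  by field.
by rewrite ler_pM2l // divr_gt0 // mulr_gt0.
Qed.
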